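(* Let $\Delta$ be a Delzant polyhedron with at least one vertex, with facet normals $\nu_1,\dots,\nu_N \in A$ and constants $\lambda_1,\dots,\lambda_N>0$, let $\Lambda_0\langle\langle H\rangle\rangle_\Delta$ be the associated complete $\Lambda_0$-algebra over the ground field $\mathbb{C}$, and let $z_j = T^{\lambda_j}\tau^{\nu_j}$ be its distinguished monomials. Then for any elements $\widehat z_1,\dots,\widehat z_N$ of $\Lambda_0\langle\langle H\rangle\rangle_\Delta$ satisfying $\widehat z_j = z_j \bmod \Lambda_+$ for all $j$, the $\Lambda_0$-algebra $$\Lambda_0\langle\langle H\rangle\rangle_\Delta \Big/ \operatorname{clos}\Big(\sum_{j=1}^N \nu_j \widehat z_j\Big)$$ is free as a $\Lambda_0$-module, where $\operatorname{clos}$ denotes closure of the ideal in the $T$-adic topology.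
   Context: Polyhedron. Let $A\cong\mathbb{Z}^n$ be a lattice, $\mathfrak{t}=A\otimes\mathbb{R}$, and $\Delta=\{x\in\mathfrak{t}^*:\langle x,\nu_j\rangle\ge-\lambda_j,\ j=1,\dots,N\}$ with $\nu_j\in A$ and real $\lambda_j>0$. Delzant condition: exactly $d$ facets meet at each codimension-$d$ face, and the normals $\nu_j$ of these $d$ facets extend to a $\mathbb{Z}$-basis of $A$. No inequality is redundant, so $\Delta$ has exactly $N$ facets $F_j=\Delta\cap\{\langle x,\nu_j\rangle=-\lambda_j\}$. $\Delta$ has at least one vertex but may be non-compact. (Geometrically $A=H_1(L;\mathbb{Z})$ for $L$ the torus fibre over $0$ in the associated toric variety $X$.) Novikov ring. $\Lambda_0=\{\sum_{j=1}^\infty a_jT^{l_j}: a_j\in\mathbb{C},\ l_j\in\mathbb{R}_{\ge0},\ l_j\to\infty\}$, with maximal ideal $\Lambda_+$ consisting of the series involving only strictly positive powers of $T$. The ring. Let $C\subset\mathbb{R}\oplus (A\otimes\mathbb{R})$ be the cone of $\mathbb{R}_{\ge0}$-linear combinations of $(1,0)$ and the vectors $(\lambda_j,\nu_j)$. For a vertex $v$ of $\Delta$ put $\theta_v(\lambda,\nu)=\lambda+\langle v,\nu\rangle$; the height of $c\in C$ is $h(c)=\min_v\theta_v(c)\ge0$. Let $\Gamma_{\mathbb{R}}=C\cap(\mathbb{R}\oplus A)$, a monoid, filtered by $F^\lambda\Gamma_{\mathbb{R}}=\{c: h(c)\ge\lambda\}=\Gamma_{\mathbb R}\cap(C+(\lambda,0))$.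 The monoid ring $\mathbb{C}[\Gamma_{\mathbb{R}}]$ inherits this filtration, and $\Lambda_0\langle\langle H\rangle\rangle_\Delta$ is its completion; its elements are possibly infinite sums of monomials $T^\lambda\tau^\nu$, $(\lambda,\nu)\in\Gamma_{\mathbb{R}}$, with complex coefficients and heights tending to infinity. It is a $\Lambda_0$-algebra and its topology is the $T$-adic one. Conventions. ''$\bmod\ \Lambda_+$'' means modulo $\Lambda_+\cdot\Lambda_0\langle\langle H\rangle\rangle_\Delta$. The expression $\sum_j\nu_j\widehat z_j$ lies in $A\otimes\Lambda_0\langle\langle H\rangle\rangle_\Delta$, and $(\sum_j\nu_j\widehat z_j)$ denotes the ideal generated by its $n$ components with respect to a basis of $A$. *)

(* Defs.v *)
From HB Require Import structures.
From mathcomp Require Import all_boot all_order all_algebra.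
From mathcomp Require Import all_classical reals topology complex.

Set Implicit Arguments.
Unset Strict Implicit.
Unset Printing Implicit Defensive.

Import Order.TTheory GRing.Theory Num.Theory.

Local Open Scope classical_set_scope.
Local Open Scope ring_scope.

Section FreeModules.
Variables (K : pzRingType) (M : lmodType K).

Definition is_basis (I : choiceType) (e : I -> M) : Prop :=
  (forall m : M, exists (s : seq I) (c : I -> K),
      m = \sum_(i <- s) c i *: e i) /\
  (forall (s : seq I) (c : I -> K), uniq s ->
      \sum_(i <- s) c i *: e i = 0 -> forall i, i \in s -> c i = 0).

Definition free_module : Prop :=
  exists (I : choiceType) (e : I -> M), is_basis e.

End FreeModules.

Section GeneratedIdeal.
Variables (A : pzRingType) (S : set A).

Definition ideal_gen : set A :=
  [set x | exists (m : nat) (a s : 'I_m -> A),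
      (forall i, S (s i)) /\ x = \sum_(i < m) a i * s i].

Lemma ideal_gen0 : ideal_gen 0.
Proof. by exists 0%N, (fun=> 0), (fun=> 0); split; [case | rewrite big_ord0]. Qed.

Lemma ideal_genD x y : ideal_gen x -> ideal_gen y -> ideal_gen (x + y).
Proof.
move=> [m [a [s [sS ->]]]] [m' [a' [s' [sS' ->]]]].
pose glue (f : 'I_m -> A) (f' : 'I_m' -> A) (i : 'I_(m + m')) :=
  match fintype.split i with inl j => f j | inr j => f' j end.
exists (m + m')%N, (glue a a'), (glue s s'); split=> [i|].
  by rewrite /glue; case: fintype.split.
rewrite big_split_ord /=; congr (_ + _); apply: eq_bigr => i _; rewrite /glue.
  by rewrite (unsplitK (inl i)).
by rewrite (unsplitK (inr i)).
Qed.

Lemma ideal_genM b x : ideal_gen x -> ideal_gen (b * x).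
Proof.
move=> [m [a [s [sS ->]]]]; exists m, (fun i => b * a i), s; split=> //.
by rewrite mulr_sumr; apply: eq_bigr => i _; rewrite mulrA.
Qed.

End GeneratedIdeal.

(* Unlike the library's [idealr], these ideals need not be proper. *)
HB.mixin Record isMulStable (A : pzRingType) (S : A -> bool) := {
  mul_stable : forall a u : A, S u -> S (a * u)
}.

#[short(type="ringIdeal")]
HB.structure Definition RingIdeal (A : pzRingType) :=
  {S of GRing.ZmodClosed A S & isMulStable A S}.

Section QuotientAlgebra.
Local Open Scope quotient_scope.
Variables (K : comNzRingType) (A : comAlgType K) (I : ringIdeal A).

Definition quot_alg : Type := Quotient.quot I.
HB.instance Definition _ := GRing.Zmodule.on quot_alg.

Let pi (x : A) : quot_alg := \pi_(Quotient.quot I) x.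

Let piP x y : reflect (pi x = pi y) (x - y \in (I : {pred A})).
Proof. by rewrite Quotient.idealrBE; apply: eqP. Qed.

Let piK (q : quot_alg) : pi (repr (q : Quotient.quot I)) = q.
Proof. exact: reprK. Qed.

Let piD x y : pi (x + y) = pi x + pi y.
Proof. exact: (raddfD (\pi_(Quotient.quot I))). Qed.

Definition quot_one : quot_alg := pi 1.
Definition quot_mul (p q : quot_alg) : quot_alg :=
  pi (repr (p : Quotient.quot I) * repr (q : Quotient.quot I)).
Definition quot_scale (a : K) (q : quot_alg) : quot_alg :=
  pi (a *: repr (q : Quotient.quot I)).

Let pi_mul x y : pi (x * y) = quot_mul (pi x) (pi y).
Proof.
apply/piP; set x' := repr _; set y' := repr _.
have hx : x - x' \in (I : {pred A}) by apply/piP; rewrite piK.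
have hy : y - y' \in (I : {pred A}) by apply/piP; rewrite piK.
have -> : x * y - x' * y' = y * (x - x') + x' * (y - y').
  by rewrite !mulrBr (mulrC y x) (mulrC y x') addrA subrK.
by apply: rpredD; apply: mul_stable.
Qed.

Let pi_scale a x : pi (a *: x) = quot_scale a (pi x).
Proof.
apply/piP; rewrite -scalerBr -mulr_algl; apply: mul_stable.
by apply/piP; rewrite piK.
Qed.

Let mulA : associative quot_mul.
Proof.
by move=> x y z; rewrite -[x]piK -[y]piK -[z]piK -!pi_mul mulrA.
Qed.
Let mulC : commutative quot_mul.
Proof. by move=> x y; rewrite -[x]piK -[y]piK -!pi_mul mulrC. Qed.
Let mul1 : left_id quot_one quot_mul.
Proof. by move=> x; rewrite -[x]piK -pi_mul mul1r. Qed.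
Let mulDl : left_distributive quot_mul +%R.
Proof.
by move=> x y z; rewrite -[x]piK -[y]piK -[z]piK -piD -!pi_mul -piD mulrDl.
Qed.

HB.instance Definition _ :=
  GRing.Zmodule_isComPzRing.Build quot_alg mulA mulC mul1 mulDl.

Let scaleA a b q : quot_scale a (quot_scale b q) = quot_scale (a * b) q.
Proof. by rewrite -[q]piK -!pi_scale scalerA. Qed.
Let scale1 : left_id 1 quot_scale.
Proof. by move=> q; rewrite -[q]piK -pi_scale scale1r. Qed.
Let scaleDr : right_distributive quot_scale +%R.
Proof.
by move=> a p q; rewrite -[p]piK -[q]piK -piD -!pi_scale -piD scalerDr.
Qed.
Let scaleDl q : {morph quot_scale^~ q : a b / a + b}.
Proof. by move=> a b; rewrite -[q]piK -!pi_scale -piD scalerDl. Qed.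

HB.instance Definition _ :=
  GRing.Zmodule_isLmodule.Build K quot_alg scaleA scale1 scaleDr scaleDl.

Lemma quot_scalerAl (a : K) (p q : quot_alg) : a *: (p * q) = (a *: p) * q.
Proof.
rewrite -[p]piK -[q]piK -[LHS]/(quot_scale a (quot_mul _ _)).
rewrite -[RHS]/(quot_mul (quot_scale a _) _).
by rewrite -pi_mul -!pi_scale -pi_mul scalerAl.
Qed.

End QuotientAlgebra.

Record heightMonoid (R : realType) (G : zmodType) := HeightMonoid {
  hm_set :> G -> Prop;
  height : G -> R;
  hm0 : hm_set 0;
  hmD : forall a b, hm_set a -> hm_set b -> hm_set (a + b);
  height_ge0 : forall a, hm_set a -> 0 <= height a;
  heightD : forall a b, hm_set a -> hm_set b ->
    height a + height b <= height (a + b) }.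

(* The completion of the monoid algebra K[M] for the filtration by height,
   as coefficient functions whose support lies in M and has only finitely
   many elements below any given height. *)
Section Completion.
Variables (R : realType) (K : comNzRingType) (G : zmodType).
Variable M : heightMonoid R G.
Local Notation h := (height M).

Definition completed_pred : {pred G -> K} :=
  [pred f | `[< (forall c, f c != 0 -> M c) /\
     (forall E : R, finite_set [set c | f c != 0 /\ h c <= E]) >]].

Record completed := Completed {
  coef :> G -> K;
  _ : coef \in completed_pred }.

HB.instance Definition _ := [isSub for coef].
HB.instance Definition _ := [Choice of completed by <:].

Let completed_zmod : zmod_closed completed_pred.
Proof.
split=> [|f g /asboolP[fM ffin] /asboolP[gM gfin]]; apply/asboolP; split.
- by move=> c; rewrite eqxx.
- move=> E; apply: (sub_finite_set _ (finite_set0 G)) => c [] /=.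
  by rewrite eqxx.
- move=> c; have -> : (f - g) c = f c - g c by [].
  have [->|/fM//] := eqVneq (f c) 0.
  by rewrite sub0r oppr_eq0; apply: gM.
- move=> E; apply: (@sub_finite_set _ _ ([set c | f c != 0 /\ h c <= E] `|`
                               [set c | g c != 0 /\ h c <= E])).
    move=> c []; have -> : (f - g) c = f c - g c by [].
    have [->|f0] := eqVneq (f c) 0; last by left.
    by rewrite sub0r oppr_eq0; right.
  by rewrite finite_setU.
Qed.
HB.instance Definition _ :=
  GRing.isZmodClosed.Build (G -> K) completed_pred completed_zmod.
HB.instance Definition _ := [SubChoice_isSubZmodule of completed by <:].

Implicit Types f g k : completed.

Lemma completedP f g : (forall c, f c = g c) -> f = g.
Proof. by move=> fg; apply/val_inj/funext. Qed.

Lemma coefD f g c : (f + g) c = f c + g c. Proof. by []. Qed.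
Lemma coefN f c : (- f) c = - f c. Proof. by []. Qed.

Lemma coef_supp f c : f c != 0 -> M c.
Proof. by case: f => f /= /asboolP[+ _]; apply. Qed.

Lemma coef_fin f E : finite_set [set c | f c != 0 /\ h c <= E].
Proof. by case: f => f /= /asboolP[_]; apply. Qed.

Definition conv (f g : G -> K) (c : G) : K :=
  \sum_(a \in [set: G]) f a * g (c - a).

Let height_le a c : M a -> M (c - a) -> M c /\ h a <= h c.
Proof.
move=> Ma Mca; rewrite -(subrK a c) addrC; split; first exact: hmD.
by apply: le_trans (heightD Ma Mca); rewrite lerDl height_ge0.
Qed.

Let mul_neq0 (x y : K) : x * y != 0 -> x != 0 /\ y != 0.
Proof.
by have [->|] := eqVneq x 0; have [->|] := eqVneq y 0;
  rewrite ?mul0r ?mulr0 ?eqxx.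
Qed.

Let conv_supp f g a c : f a * g (c - a) != 0 ->
  [/\ f a != 0, g (c - a) != 0, M a, M c & h a <= h c].
Proof.
move=> /mul_neq0[fa ga].
have Ma := coef_supp fa; have Mca := coef_supp ga.
by have [] := height_le Ma Mca.
Qed.

Let convE f g c (A : set G) :
  (forall a, f a != 0 -> h a <= h c -> A a) ->
  conv f g c = \sum_(a \in A) f a * g (c - a).
Proof.
move=> fA; apply/esym/fsbig_widen => // a [_ nAa].
by apply: contra_notP nAa => /eqP /conv_supp[? _ _ _ ?]; apply: fA.
Qed.

Let conv_closed f g : conv f g \in completed_pred.
Proof.
have nz c : conv f g c != 0 -> exists2 a, f a != 0 & g (c - a) != 0.
  by move=> /(fsbigN1 (f := fun c a => f a * g (c - a)))[a _ /mul_neq0[]]; exists a.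
apply/asboolP; split=> [c /nz[a fa ga]|E].
  by have [] := height_le (coef_supp fa) (coef_supp ga).
pose A : set G := [set a | f a != 0 /\ h a <= E].
pose B : set G := [set b | g b != 0 /\ h b <= E].
apply: (@sub_finite_set _ _ [set a + b | a in A & b in B]).
  move=> c [/nz[a fa ga] hc]; have Ma := coef_supp fa.
  have Mca := coef_supp ga; exists a.
    by split=> //; apply: le_trans hc; have [] := height_le Ma Mca.
  exists (c - a); last by rewrite addrC subrK.
  split=> //; apply: le_trans hc; apply: (height_le Mca _).2.
  by rewrite opprB addrC subrK.
by apply: finite_image2; exact: coef_fin.
Qed.

Definition completed_mul f g := Completed (conv_closed f g).

Definition delta (c : G) : G -> K := fun b => if b == c then 1 else 0.

Lemma delta_closed c : M c -> delta c \in completed_pred.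
Proof.
move=> Mc; apply/asboolP; split=> [b|E]; rewrite /delta.
  by case: (eqVneq b c) => [-> //|_]; rewrite eqxx.
apply: (sub_finite_set _ (finite_set1 c)) => b [].
by case: (eqVneq b c) => [-> //|_]; rewrite eqxx.
Qed.

Definition monomial c (Mc : M c) : completed := Completed (delta_closed Mc).

Definition completed_one := monomial (hm0 M).

Let mulC : commutative completed_mul.
Proof.
move=> f g; apply: completedP => c; rewrite /= /conv.
rewrite (reindex_fsbigT (fun a => c - a)).
  by apply: eq_fsbigr => a _; rewrite subKr mulrC.
by exists (fun a => c - a) => a; rewrite subKr.
Qed.

Let mul1 : left_id completed_one completed_mul.
Proof.
move=> f; apply: completedP => c; rewrite /= /conv.
rewrite -(@fsbig_widen _ _ _ _ [set 0]) //.
  by rewrite fsbig_set1 /delta eqxx mul1r subr0.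
by move=> a [_ /eqP a0] /=; rewrite /delta (negPf a0) mul0r.
Qed.

Let mulDl : left_distributive completed_mul +%R.
Proof.
move=> f g k; apply: completedP => c; rewrite coefD.
rewrite -[LHS]/(conv (f + g) k c) -[RHS]/(conv f k c + conv g k c).
pose A := [set a | f a != 0 /\ h a <= h c] `|`
          [set a | g a != 0 /\ h a <= h c].
have Afin : finite_set A by rewrite finite_setU; split; apply: coef_fin.
have -> : conv f k c = \sum_(a \in A) f a * k (c - a).
  by apply: convE => a fa ha; left.
have -> : conv g k c = \sum_(a \in A) g a * k (c - a).
  by apply: convE => a fa ha; right.
rewrite (@convE (f + g) k c A); last first.
  move=> a; rewrite coefD; have [->|fa] := eqVneq (f a) 0.
    by rewrite add0r => ga ha; right.
  by move=> _ ha; left.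
rewrite -fsbig_split //; apply: eq_fsbigr => a _.
by rewrite coefD mulrDl.
Qed.

Let mulA : associative completed_mul.
Proof.
move=> f g k; apply/esym/completedP => c /=.
pose A := [set a | f a != 0 /\ h a <= h c].
pose B := [set b | g b != 0 /\ h b <= h c].
pose AB := [set a + b | a in A & b in B].
have Afin : finite_set A by apply: coef_fin.
have Bfin : finite_set B by apply: coef_fin.
have ABfin : finite_set AB by apply: finite_image2.
rewrite (@convE f (completed_mul g k) c A) //.
rewrite (@convE (completed_mul f g) k c AB); last first.
  move=> b /(fsbigN1 (f := fun b a => f a * g (b - a)))[a _] /conv_supp[fa ga Ma Mb ha] hb.
  exists a; first by split=> //; apply: le_trans hb.
  exists (b - a); last by rewrite addrC subrK.
  split=> //; apply: le_trans hb; apply: (height_le (coef_supp ga) _).2.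
  by rewrite subKr.
transitivity (\sum_(b \in AB) \sum_(a \in A) f a * g (b - a) * k (c - b)).
  apply: eq_fsbigr => b _ /=.
  have [->|kcb] := eqVneq (k (c - b)) 0.
    by rewrite mulr0 fsbig1 // => a _; rewrite mulr0.
  have -> : conv f g b = \sum_(a \in A) f a * g (b - a).
    apply/esym/fsbig_widen => // a [_ nAa].
    apply: contra_notP nAa => /eqP /conv_supp[fa ga Ma Mb ha].
    split=> //; apply: le_trans ha _.
    by have [] := height_le Mb (coef_supp kcb).
  by rewrite !fsbig_finite // mulr_suml.
rewrite !fsbig_finite //.
under eq_bigr do rewrite fsbig_finite //.
rewrite exchange_big /= [LHS]big_seq [RHS]big_seq; apply: eq_bigr => a.
rewrite in_fset_set // inE => -[fa ha].
under eq_bigr do rewrite -mulrA.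
rewrite -mulr_sumr -fsbig_finite //; congr (_ * _).
rewrite -[RHS]/(conv g k (c - a)) /conv.
rewrite [RHS](reindex_fsbigT (fun b => b - a)); last first.
  by exists (fun b => b + a) => b; rewrite ?subrK ?addrK.
rewrite -[RHS](@fsbig_widen _ _ _ _ AB) //.
  by apply: eq_fsbigr => b _; rewrite opprB addrA subrK.
move=> b [_ nAB]; apply: contra_notP nAB => /eqP.
case/conv_supp => gb kb Mb Mca hb.
exists a; first by split.
exists (b - a); last by rewrite addrC subrK.
split=> //; apply: le_trans hb _.
by apply: (height_le Mca _).2; rewrite subKr; apply: coef_supp fa.
Qed.

Let one_neq0 : completed_one != 0.
Proof.
apply/eqP => /(congr1 (fun f : completed => f 0)) /eqP.
by rewrite /= /delta eqxx [X in _ == X]/(0 : K) oner_eq0.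
Qed.

HB.instance Definition _ := GRing.Zmodule_isComNzRing.Build completed
  mulA mulC mul1 mulDl one_neq0.

Lemma coefM f g c : (f * g) c = conv f g c. Proof. by []. Qed.
Lemma coef1 c : (1 : completed) c = delta 0 c. Proof. by []. Qed.

End Completion.

Section Novikov.
Variable R : realType.

Let id_ge0 (a : R) : 0 <= a -> 0 <= id a. Proof. by []. Qed.
Let idD (a b : R) : 0 <= a -> 0 <= b -> id a + id b <= id (a + b).
Proof. by []. Qed.

Definition novikov_exponents : heightMonoid R R :=
  HeightMonoid (lexx 0) (@addr_ge0 R) id_ge0 idD.

(* The coefficient of T^l in a is [a l]. *)
Definition novikov : Type := completed R[i] novikov_exponents.
HB.instance Definition _ := GRing.ComNzRing.on novikov.

Definition novikov_max : set novikov := [set a | forall l, a l != 0 -> 0 < l].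

Definition Tpow (l : R) (l0 : 0 <= l) : novikov :=
  @monomial R R[i] R novikov_exponents l l0.

Lemma TpowD l l' (l0 : 0 <= l) (l0' : 0 <= l') (s0 : 0 <= l + l') :
  Tpow s0 = Tpow l0 * Tpow l0'.
Proof.
apply: completedP => c.
rewrite -[RHS]/(conv (Tpow l0) (Tpow l0') c) /conv.
rewrite -(@fsbig_widen _ _ _ _ [set l]) //.
  rewrite fsbig_set1 /= /delta eqxx mul1r.
  by rewrite [c - l == _]subr_eq addrC.
by move=> a [_ /eqP al] /=; rewrite /delta (negPf al) mul0r.
Qed.

End Novikov.

Section Polyhedra.
Variables (R : realType) (n : nat).

(* The lattice A is Z^n, and both t = A (x) R and its dual are R^n. *)
Definition pairing (x v : 'rV[R]_n) : R := \sum_(i < n) x 0 i * v 0 i.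

Definition realify (v : 'rV[int]_n) : 'rV[R]_n := map_mx intr v.

Definition is_face (P F : set 'rV[R]_n) : Prop :=
  exists (u : 'rV[R]_n) (b : R), (forall x, P x -> b <= pairing x u) /\
    F = P `&` [set x | pairing x u = b] /\ F !=set0.

Definition is_vertex (P : set 'rV[R]_n) (v : 'rV[R]_n) : Prop :=
  is_face P [set v].

(* The affine hull of S has dimension d: S contains d + 1 affinely
   independent points whose affine span contains S. *)
Definition affine_dim (S : set 'rV[R]_n) (d : nat) : Prop :=
  exists x0 (B : 'M[R]_(d, n)), [/\ S x0, row_free B,
    forall i, S (x0 + row i B) & forall x, S x -> (x - x0 <= B)%MS].

Section Halfspaces.
Variables (N : nat) (nu : 'I_N -> 'rV[int]_n) (lam : 'I_N -> R).

Definition polyhedron_set : set 'rV[R]_n :=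
  [set x | forall j, - lam j <= pairing x (realify (nu j))].

Definition irredundant : Prop := forall j, exists x,
  (forall i, i != j -> - lam i <= pairing x (realify (nu i))) /\
  ~ (- lam j <= pairing x (realify (nu j))).

Definition facet (j : 'I_N) : set 'rV[R]_n :=
  polyhedron_set `&` [set x | pairing x (realify (nu j)) = - lam j].

Definition facets_through (F : set 'rV[R]_n) : {set 'I_N} :=
  [set j | `[< F `<=` facet j >]]%SET.

(* The family (nu j), j in J, is part of a Z-basis (the rows of B). *)
Definition extends_to_basis (J : {set 'I_N}) : Prop :=
  {in J &, injective nu} /\
  exists2 B : 'M[int]_n, B \in unitmx &
    forall j, j \in J -> exists i, nu j = row i B.

End Halfspaces.

Record polyhedron (N : nat) := Polyhedron {
  normal : 'I_N -> 'rV[int]_n;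
  offset : 'I_N -> R;
  offset_gt0 : forall j, 0 < offset j;
  no_redundancy : irredundant normal offset;
  has_vertex : exists v, is_vertex (polyhedron_set normal offset) v }.

Definition region N (D : polyhedron N) : set 'rV[R]_n :=
  polyhedron_set (normal D) (offset D).

Definition delzant N (D : polyhedron N) : Prop :=
  forall (F : set 'rV[R]_n) (d k : nat), (d + k = n)%N ->
    is_face (region D) F -> affine_dim F k ->
    #|facets_through (normal D) (offset D) F| = d /\
    extends_to_basis (normal D) (facets_through (normal D) (offset D) F).

Section CompletedRing.
Variables (N : nat) (D : polyhedron N).
Local Notation nuR j := (realify (normal D j)).

Definition cone : set (R * 'rV[R]_n) :=
  [set c | exists (s : R) (a : 'I_N -> R), [/\ 0 <= s, forall j, 0 <= a j &
    c = (s + \sum_j a j * offset D j, \sum_j a j *: nuR j)]].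

Definition theta (v : 'rV[R]_n) (c : R * 'rV[R]_n) : R :=
  c.1 + pairing v c.2.

(* There are finitely many vertices, so that this infimum is a minimum. *)
Definition cone_height (c : R * 'rV[R]_n) : R :=
  inf [set theta v c | v in is_vertex (region D)].

Definition to_real (c : R * 'rV[int]_n) : R * 'rV[R]_n := (c.1, realify c.2).

Definition Gamma : (R * 'rV[int]_n) -> Prop := fun c => cone (to_real c).

Definition Gamma_height (c : R * 'rV[int]_n) : R := cone_height (to_real c).

Let pairingD v x y : pairing v (x + y) = pairing v x + pairing v y.
Proof.
by rewrite /pairing -big_split; apply: eq_bigr => i _; rewrite mxE mulrDr.
Qed.
Let pairingZ v a x : pairing v (a *: x) = a * pairing v x.
Proof.
by rewrite /pairing mulr_sumr; apply: eq_bigr => i _; rewrite mxE mulrCA.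
Qed.
Let pairing0 v : pairing v 0 = 0.
Proof. by rewrite -(scale0r 0) pairingZ mul0r. Qed.
Let pairing_sum v (f : 'I_N -> 'rV[R]_n) :
  pairing v (\sum_j f j) = \sum_j pairing v (f j).
Proof. exact: (big_morph (pairing v) (pairingD v) (pairing0 v)). Qed.

Let to_realD a b : to_real (a + b) = to_real a + to_real b.
Proof. by rewrite /to_real /realify /= map_mxD. Qed.

Let vertex_region v : is_vertex (region D) v -> region D v.
Proof.
by move=> [u [b [_ [/seteqP[vF _] _]]]]; case: (vF v erefl).
Qed.

Let theta_ge0 v c : region D v -> cone c -> 0 <= theta v c.
Proof.
move=> Dv [s [a [s0 a0 ->]]]; rewrite /theta /= pairing_sum -addrA -big_split.
rewrite addr_ge0 // sumr_ge0 // => j _; rewrite pairingZ /= -mulrDr mulr_ge0 //.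
by rewrite addrC -[offset D j]opprK subr_ge0; apply: Dv.
Qed.

Let theta_lb c : cone c -> lbound [set theta v c | v in is_vertex (region D)] 0.
Proof. by move=> Cc _ [v Dv <-]; apply: theta_ge0 => //; apply: vertex_region. Qed.

Let theta_n0 c : [set theta v c | v in is_vertex (region D)] !=set0.
Proof. by have [v Dv] := has_vertex D; exists (theta v c), v. Qed.

Let Gamma0 : Gamma 0.
Proof.
exists 0, (fun=> 0); split=> //; rewrite /to_real /= /realify map_mx0.
by rewrite add0r !big1 // => j _; rewrite ?mul0r ?scale0r.
Qed.

Let GammaD a b : Gamma a -> Gamma b -> Gamma (a + b).
Proof.
move=> [s [f [s0 f0 ea]]] [t [g [t0 g0 eb]]].
exists (s + t), (fun j => f j + g j); split=> [|j|]; rewrite ?addr_ge0 //.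
rewrite to_realD ea eb; congr pair.
  by rewrite /= addrACA -big_split; congr (_ + _); apply: eq_bigr => j _;
    rewrite mulrDl.
by rewrite /= -big_split; apply: eq_bigr => j _; rewrite scalerDl.
Qed.

Let Gamma_height_ge0 a : Gamma a -> 0 <= Gamma_height a.
Proof. by move=> Ga; apply: lb_le_inf => //; apply: theta_lb. Qed.

Let Gamma_heightD a b : Gamma a -> Gamma b ->
  Gamma_height a + Gamma_height b <= Gamma_height (a + b).
Proof.
move=> Ga Gb; apply: lb_le_inf => // _ [v Dv <-].
have -> : theta v (to_real (a + b)) = theta v (to_real a) + theta v (to_real b).
  by rewrite to_realD /theta /= pairingD addrACA.
have lb c : Gamma c -> Gamma_height c <= theta v (to_real c).
  by move=> Gc; apply: (ge_inf (ex_intro _ 0 (theta_lb Gc))); exists v.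
by apply: lerD; apply: lb.
Qed.

Definition GammaM : heightMonoid R (R * 'rV[int]_n)%type :=
  HeightMonoid Gamma0 GammaD Gamma_height_ge0 Gamma_heightD.

(* The coefficient of T^l tau^nu in f is [f (l, nu)]. *)
Definition LambdaH : Type := completed R[i] GammaM.
HB.instance Definition _ := GRing.ComNzRing.on LambdaH.

Lemma Gamma_generator j : Gamma (offset D j, normal D j).
Proof.
exists 0, (fun i => (i == j)%:R); split=> //; congr pair; last first.
  rewrite /= (bigD1 j) //= eqxx scale1r big1 ?addr0 //.
  by move=> i /negPf->; rewrite scale0r.
rewrite add0r (bigD1 j) //= eqxx mul1r big1 ?addr0; last first.
  by move=> i /negPf->; rewrite mul0r.
by [].
Qed.

Definition zmon (j : 'I_N) : LambdaH :=
  @monomial R R[i] _ GammaM _ (Gamma_generator j).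

(* The structure map of the algebra, sending T^l to T^l tau^0. *)
Definition embed_fun (a : novikov R) (c : R * 'rV[int]_n) : R[i] :=
  if c.2 == 0 then a c.1 else 0.

Let Gamma_T l : 0 <= l -> Gamma (l, 0).
Proof.
move=> l0; exists l, (fun=> 0); split=> //; rewrite /to_real /= /realify map_mx0.
by rewrite !big1 ?addr0 // => j _; rewrite ?mul0r ?scale0r.
Qed.

Let height_T l : Gamma_height (l, 0) = l.
Proof.
rewrite /Gamma_height /cone_height.
have -> : [set theta v (to_real (l, 0)) | v in is_vertex (region D)] = [set l].
  have thE v : theta v (to_real (l, 0)) = l.
    by rewrite /theta /to_real /= /realify map_mx0 pairing0 addr0.
  apply/seteqP; split=> [_ [v _ <-] //|_ ->].
  by have [v Dv] := has_vertex D; exists v.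
exact: inf1.
Qed.

Lemma embed_closed a : embed_fun a \in @completed_pred R R[i] _ GammaM.
Proof.
apply/asboolP; split=> [[l v]|E]; rewrite /embed_fun /=.
  case: (eqVneq v 0) => [->|_]; last by rewrite eqxx.
  by move=> /coef_supp; apply: Gamma_T.
apply: (@sub_finite_set _ _ [set (l, 0) | l in [set l | a l != 0 /\ l <= E]]).
  move=> [l v] /= []; case: (eqVneq v 0) => [->|_]; last by rewrite eqxx.
  by rewrite height_T => al lE; exists l.
by apply: finite_image; apply: coef_fin.
Qed.

Definition embed (a : novikov R) : LambdaH := Completed (embed_closed a).

Let embedD a b : embed (a + b) = embed a + embed b.
Proof.
apply: completedP => c; rewrite coefD /= /embed_fun.
by case: eqP => _; rewrite ?addr0.
Qed.

Let embed1 : embed 1 = 1.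
Proof.
apply: completedP => -[l v]; rewrite coef1 /= /embed_fun /= /delta.
rewrite -[X in _ = if X then _ else _]/((l == 0) && (v == 0)) andbC.
by case: (v == 0).
Qed.

Let embedM a b : embed (a * b) = embed a * embed b.
Proof.
apply: completedP => -[l v].
rewrite -[RHS]/(conv (embed a) (embed b) (l, v)) /conv.
pose i0 (s : R) : R * 'rV[int]_n := (s, 0).
rewrite -(@fsbig_widen _ _ _ _ (i0 @` setT)) //; last first.
  move=> [s w] [_ nw] /=; rewrite /embed_fun /=; case: eqP => [w0|_].
    by case: nw; exists s; rewrite // w0.
  by rewrite mul0r.
rewrite fsbig_image; last by move=> x y _ _ [].
rewrite /= /embed_fun /= eqxx; case: eqP => [->|/eqP v0].
  rewrite -[LHS]/(conv a b l); apply: eq_fsbigr => s _.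
  by rewrite subr0 eqxx.
by rewrite fsbig1 // => s _; rewrite subr0 (negPf v0) mulr0.
Qed.

Definition LH_scale (a : novikov R) (f : LambdaH) : LambdaH := embed a * f.

Let scaleA a b f : LH_scale a (LH_scale b f) = LH_scale (a * b) f.
Proof. by rewrite /LH_scale embedM mulrA. Qed.
Let scale1 : left_id 1 LH_scale.
Proof. by move=> f; rewrite /LH_scale embed1 mul1r. Qed.
Let scaleDr : right_distributive LH_scale +%R.
Proof. by move=> a f g; rewrite /LH_scale mulrDr. Qed.
Let scaleDl f : {morph LH_scale^~ f : a b / a + b}.
Proof. by move=> a b; rewrite /LH_scale embedD mulrDl. Qed.

HB.instance Definition _ := GRing.Zmodule_isLmodule.Build (novikov R) LambdaH
  scaleA scale1 scaleDr scaleDl.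

Let scaleAl (a : novikov R) (f g : LambdaH) : a *: (f * g) = (a *: f) * g.
Proof. exact: mulrA. Qed.
HB.instance Definition _ :=
  GRing.Lmodule_isLalgebra.Build (novikov R) LambdaH scaleAl.
HB.instance Definition _ :=
  GRing.Lalgebra_isComAlgebra.Build (novikov R) LambdaH.

(* The T-adic topology. *)
Definition LH_nbhs (f : LambdaH) : set_system LambdaH :=
  [set B | exists (E : R) (E0 : 0 <= E), forall w, B (f + Tpow E0 *: w)].

HB.instance Definition _ := hasNbhs.Build LambdaH LH_nbhs.

Let LH_nbhs_filter (f : LambdaH) : ProperFilter (nbhs f).
Proof.
split=> [[E [E0 /(_ 0)]] //|]; split.
- by exists 0, (lexx 0).
- move=> P Q [E [E0 PE]] [E' [E0' QE]].
  exists (E + E'), (addr_ge0 E0 E0') => w; split.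
    by rewrite (TpowD E0 E0') -scalerA; apply: PE.
  by rewrite (TpowD E0 E0') mulrC -scalerA; apply: QE.
- by move=> P Q PQ [E [E0 PE]]; exists E, E0 => w; apply: PQ.
Qed.

Let LH_nbhs_singleton (f : LambdaH) B : nbhs f B -> B f.
Proof. by move=> [E [E0 /(_ 0)]]; rewrite scaler0 addr0. Qed.

Let LH_nbhs_nbhs (f : LambdaH) B : nbhs f B -> nbhs f (nbhs^~ B).
Proof.
move=> [E [E0 BE]]; exists E, E0 => w; exists E, E0 => w'.
by rewrite -addrA -scalerDr; apply: BE.
Qed.

HB.instance Definition _ := Nbhs_isNbhsTopological.Build LambdaH
  LH_nbhs_filter LH_nbhs_singleton LH_nbhs_nbhs.

(* The closure of the ideal generated by S. *)
Definition closed_ideal (S : set LambdaH) : {pred LambdaH} :=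
  mem (closure (ideal_gen S)).

Lemma closed_idealP (S : set LambdaH) x :
  reflect (forall (E : R) (E0 : 0 <= E),
             exists2 y, ideal_gen S y & exists w, y = x + Tpow E0 *: w)
          (closed_ideal S x).
Proof.
apply: (iffP idP) => [|h].
  rewrite /closed_ideal /= inE => h E E0.
  have [] := h [set y | exists w, y = x + Tpow E0 *: w].
    by exists E, E0 => w; exists w.
  by move=> y [Sy ?]; exists y.
rewrite /closed_ideal /= inE => B [E [E0 BE]].
by have [y Sy [w ey]] := h E E0; exists y; split=> //; rewrite ey.
Qed.

Section ClosedIdeal.
Variable S : set LambdaH.

Let closed_ideal_mul (a u : LambdaH) :
  closed_ideal S u -> closed_ideal S (a * u).
Proof.
move=> /closed_idealP h; apply/closed_idealP => E E0.
have [y Sy [w ey]] := h E E0; exists (a * y); first exact: ideal_genM.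
by exists (a * w); rewrite ey mulrDr scalerAr.
Qed.

Let closed_ideal_zmod : zmod_closed (closed_ideal S).
Proof.
split=> [|x y Sx Sy]; apply/closed_idealP => E E0.
  by exists 0; [exact: ideal_gen0 | exists 0; rewrite scaler0 addr0].
have [x' Sx' [w ex]] := elimT (closed_idealP S x) Sx E E0.
have [y' Sy' [w' ey]] := elimT (closed_idealP S y) Sy E E0.
exists (x' - y').
  by apply: ideal_genD => //; rewrite -mulN1r; apply: ideal_genM.
by exists (w - w'); rewrite ex ey scalerBr opprD addrACA.
Qed.

HB.instance Definition _ :=
  GRing.isZmodClosed.Build LambdaH (closed_ideal S) closed_ideal_zmod.
HB.instance Definition _ :=
  isMulStable.Build LambdaH (closed_ideal S) closed_ideal_mul.
End ClosedIdeal.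

Definition eq_mod_max (f g : LambdaH) : Prop :=
  ideal_gen [set a%:A | a in @novikov_max R] (f - g).

Definition linear_component (zhat : 'I_N -> LambdaH) (i : 'I_n) : LambdaH :=
  \sum_j (normal D j 0 i)%:~R * zhat j.

Definition quotient_algebra (zhat : 'I_N -> LambdaH) : lmodType (novikov R) :=
  quot_alg (closed_ideal (range (linear_component zhat))).

End CompletedRing.
End Polyhedra.

(* Main.v *)
(* Write theta_v(c) for the value at a vertex v, so that a monomial c has height 0
   exactly when some theta_v(c) is 0, and a product of height-0 monomials has height
   0 exactly when some theta_v vanishes on both factors. The positive heights so
   obtained are bounded away from 0, hence modulo T^eps, for small eps, the ring is
   a Stanley-Reisner ring with coefficients in Lambda_0/T^eps.

   Order the vertices by a generic functional xi, bounded below on the polyhedron.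
   Each height-0 monomial c is z_v * prod_i z_{v,i}^(al i), where v is the xi-lowest
   vertex with theta_v(c) = 0, the z_{v,i} are the generators of the facets through
   v, and z_v is the product of those z_{v,i} whose dual edge at v is descending. As
   the normals at v form a Z-basis, the ideal contains linear forms with leading
   part z_{v,i} + (a combination of generators of facets not through v). Replacing
   z_{v,i} by these forms in prod_i z_{v,i}^(al i) changes the monomial, modulo
   T^eps, only by monomials belonging to xi-higher vertices. Hence the resulting
   elements Ehat v al are a topological basis of the ring over Lambda_0; those with
   al <> 0 topologically span the closed ideal, and those with al = 0, one for each
   vertex, give a basis of the quotient. *)

Require Import Defs.
From mathcomp Require Import all_boot all_order all_algebra.
From mathcomp Require Import all_classical reals topology complex.
From mathcomp Require Import finmap ring lra.

Set Implicit Arguments.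
Unset Strict Implicit.
Unset Printing Implicit Defensive.

Import Order.TTheory GRing.Theory Num.Theory.

Local Open Scope classical_set_scope.
Local Open Scope ring_scope.

(** * Polyhedra: frames, edges and vertices *)

Section Pairing.
Variables (R : realType) (n : nat).
Implicit Types x y : 'rV[R]_n.

Lemma pairingE x y : pairing x y = (x *m y^T) 0 0.
Proof. by rewrite mxE; apply: eq_bigr => i _; rewrite mxE. Qed.

Lemma pairingC x y : pairing x y = pairing y x.
Proof. by apply: eq_bigr => i _; rewrite mulrC. Qed.

Lemma pairingDl x x' y : pairing (x + x') y = pairing x y + pairing x' y.
Proof. by rewrite !pairingE mulmxDl mxE. Qed.

Lemma pairingDr x y y' : pairing x (y + y') = pairing x y + pairing x y'.
Proof. by rewrite !(pairingC x) pairingDl. Qed.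

Lemma pairingZl a x y : pairing (a *: x) y = a * pairing x y.
Proof. by rewrite !pairingE -scalemxAl mxE. Qed.

Lemma pairingZr a x y : pairing x (a *: y) = a * pairing x y.
Proof. by rewrite !(pairingC x) pairingZl. Qed.

Lemma pairing0l y : pairing 0 y = 0.
Proof. by rewrite -(scale0r 0) pairingZl mul0r. Qed.

Lemma pairing0r x : pairing x 0 = 0.
Proof. by rewrite pairingC pairing0l. Qed.

Lemma pairingBl x x' y : pairing (x - x') y = pairing x y - pairing x' y.
Proof. by rewrite -scaleN1r pairingDl pairingZl mulN1r. Qed.

Lemma pairing_sumr (I : Type) (r : seq I) (P : pred I) x (F : I -> 'rV[R]_n) :
  pairing x (\sum_(i <- r | P i) F i) = \sum_(i <- r | P i) pairing x (F i).
Proof. exact: (big_morph (pairing x) (pairingDr x) (pairing0r x)). Qed.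

Lemma pairing_suml (I : Type) (r : seq I) (P : pred I) y (F : I -> 'rV[R]_n) :
  pairing (\sum_(i <- r | P i) F i) y = \sum_(i <- r | P i) pairing (F i) y.
Proof. by rewrite pairingC pairing_sumr; apply: eq_bigr => i _; apply: pairingC. Qed.

Lemma realifyD (u v : 'rV[int]_n) : realify R (u + v) = realify R u + realify R v.
Proof. exact: map_mxD. Qed.

Lemma realify0 : realify R (0 : 'rV[int]_n) = 0.
Proof. exact: map_mx0. Qed.

End Pairing.

Section Frames.
Variables (R : realType) (n N : nat) (D : polyhedron R n N).
Local Notation nuR j := (realify R (normal D j)).
Local Notation lam j := (offset D j).

(** Coordinate form of the Delzant condition at a vertex: the tight facets are numbered by ['I_n],
    with normals the rows of a unimodular matrix. Invertibility forces [tight] to be injective. *)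
Record frame (v : 'rV[R]_n) := Frame {
  tight : 'I_n -> 'I_N;
  frame_mx : 'M[int]_n;
  frame_unit : frame_mx \in unitmx;
  row_frame : forall i, row i frame_mx = normal D (tight i);
  frame_region : region D v;
  tightP : forall k, pairing v (nuR k) = - lam k <-> exists i, k = tight i }.

(** The condition is applied to [v] as a zero-dimensional face: exactly [n] facets are tight there,
    with distinct normals among the rows of a unimodular matrix. *)
Lemma delzant_frame (hD : delzant D) v : is_vertex (region D) v ->
  exists _ : frame v, True.
Proof.
move=> vx.
have Dv : region D v.
  by move: vx => [u [b [_ [/seteqP[vF _] _]]]]; case: (vF v erefl).
have [||cJ [injJ [B Bu BJ]]] := hD [set v] n 0%N (addn0 n).
- exact: vx.
- exists v, 0; split => //; first by rewrite -row_leq_rank.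
    by case.
  by move=> x ->; rewrite subrr sub0mx.
set J := facets_through _ _ _ in cJ injJ BJ.
have JP k : reflect (pairing v (nuR k) = - lam k) (k \in J).
  rewrite inE; apply: (iffP (asboolP _)) => [h|e x ->]; last by split.
  by have [] := h v erefl.
pose f (k : 'I_N) : option 'I_n := [pick i | normal D k == row i B].
have fJ k : k \in J -> exists2 i, f k = Some i & normal D k = row i B.
  move=> kJ; rewrite /f; case: pickP => [i /eqP e|no]; first by exists i.
  by have [i /eqP] := BJ k kJ; rewrite no.
have finj : {in J &, injective f}.
  move=> k k' kJ kJ' e; apply: injJ => //.
  have [i ei ->] := fJ k kJ; have [i' ei' ->] := fJ k' kJ'.
  by move: e; rewrite ei ei' => -[->].
(* Counting: [f] injects the [n] facets through [v] into the [n] rows, so every row is a normal. *)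
have fim : f @: J = [set Some i | i in [set: 'I_n]]%SET.
  apply/eqP; rewrite eqEcard (card_in_imset finj) card_imset; last by move=> ? ? [].
  rewrite cardsT card_ord cJ leqnn andbT; apply/fintype.subsetP => _ /imsetP[k kJ ->].
  by have [i -> _] := fJ k kJ; apply: imset_f; rewrite inE.
have exk i : exists k, k \in J /\ normal D k = row i B.
  have : Some i \in f @: J by rewrite fim; apply: imset_f; rewrite inE.
  move=> /imsetP[k kJ e]; exists k; split => //.
  by have [i' ei' ->] := fJ k kJ; move: e; rewrite ei' => -[->].
have [g gP] := choice exk.
have gt k : pairing v (nuR k) = - lam k <-> exists i, k = g i.
  split=> [/JP kJ|[i ->]]; last by apply/JP; case: (gP i).
  have [i _ e] := fJ k kJ; exists i; have [gJ ge] := gP i.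
  by apply: injJ => //; rewrite e ge.
by exists (Frame Bu (fun i => esym (gP i).2) Dv gt).
Qed.

Section FrameTheory.
Variables (v : 'rV[R]_n) (fr : frame v).
Local Notation B := (frame_mx fr).
Local Notation jv := (tight fr).

Definition coordz (x : 'rV[int]_n) (i : 'I_n) : int := (x *m invmx B) 0 i.

(* The basis dual to the normals of the facets through v. *)
Definition edge (i : 'I_n) : 'rV[R]_n := \row_k (invmx B k i)%:~R.

Lemma pairing_edge i x : pairing (edge i) (realify R x) = (coordz x i)%:~R.
Proof.
rewrite /coordz mxE rmorph_sum; apply: eq_bigr => k _.
by rewrite !mxE rmorphM mulrC.
Qed.

Lemma coordz_normal i k : coordz (normal D (jv k)) i = (i == k)%:R.
Proof.
rewrite /coordz -row_frame -row_mul mulmxV ?frame_unit // !mxE.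
by rewrite eq_sym; case: (k == i).
Qed.

Lemma coordzK x : x = \sum_i coordz x i *: normal D (jv i).
Proof.
rewrite -[LHS](mulmxKV (frame_unit fr)) mulmx_sum_row.
by apply: eq_bigr => i _; rewrite row_frame.
Qed.

Lemma edge_normal i k : pairing (edge i) (nuR (jv k)) = (i == k)%:R.
Proof. by rewrite pairing_edge coordz_normal; case: (i == k). Qed.

Lemma edgeK y : y = \sum_i pairing y (nuR (jv i)) *: edge i.
Proof.
pose C : 'M[R]_n := map_mx intr B; pose C' : 'M[R]_n := map_mx intr (invmx B).
have CC : C' *m C = 1%:M by rewrite -map_mxM mulVmx ?frame_unit // map_mx1.
have -> : y = (y *m C^T) *m C'^T by rewrite -mulmxA -trmx_mul CC trmx1 mulmx1.
rewrite [LHS]mulmx_sum_row; apply: eq_bigr => i _; congr (_ *: _).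
  rewrite -mulmxA -trmx_mul CC trmx1 mulmx1 mxE; apply: eq_bigr => k _.
  by rewrite -row_frame !mxE.
by apply/rowP => k; rewrite !mxE.
Qed.

Lemma pairing_frame y z : pairing y z =
  \sum_i pairing y (nuR (jv i)) * pairing (edge i) z.
Proof.
by rewrite {1}(edgeK y) pairing_suml; apply: eq_bigr => i _; rewrite pairingZl.
Qed.

Lemma frame_eq0 y : (forall i, pairing y (nuR (jv i)) = 0) -> y = 0.
Proof. by move=> y0; rewrite (edgeK y) big1 // => i _; rewrite y0 scale0r. Qed.

Lemma pairing_tight i : pairing v (nuR (jv i)) = - lam (jv i).
Proof. by apply/tightP; exists i. Qed.

End FrameTheory.

(** The supporting functional is the sum of the tight normals. Where the sum attains its bound, so
    does each summand, and full rank of the tight normals then leaves only [v]. *)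
Lemma tight_vertex v : region D v ->
  (forall y, (forall k, pairing v (nuR k) = - lam k -> pairing y (nuR k) = 0) ->
     y = 0) -> is_vertex (region D) v.
Proof.
move=> Dv full; pose T k := pairing v (nuR k) == - lam k.
exists (\sum_(k | T k) nuR k), (\sum_(k | T k) - lam k); split=> [x Dx|].
  by rewrite pairing_sumr; apply: ler_sum => k _; apply: Dx.
split; last by exists v.
apply/seteqP; split=> [_ ->|x [Dx /= e]].
  by split=> //=; rewrite pairing_sumr; apply: eq_bigr => k /eqP.
have xT k : T k -> pairing x (nuR k) = - lam k.
  move=> Tk; apply/eqP; rewrite eq_le Dx andbT.
  move: e; rewrite pairing_sumr (bigD1 k) //= [in RHS](bigD1 k) //= => e.
  have : \sum_(i | T i && (i != k)) - lam i <=
      \sum_(i | T i && (i != k)) pairing x (nuR i).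
    by apply: ler_sum => i _; apply: Dx.
  lra.
apply/eqP; rewrite -subr_eq0; apply/eqP/full => k vk.
by rewrite pairingBl vk xT ?subrr //; apply/eqP.
Qed.

(* Walking along the edge until a new inequality becomes tight. *)
Lemma edge_end v (fr : frame v) i :
  (forall k, 0 <= pairing (edge fr i) (nuR k)) \/
  (exists w t, [/\ 0 < t, is_vertex (region D) w & w = v + t *: edge fr i]).
Proof.
pose e := edge fr i.
have [|/existsNP[k0 /negP]] := pselect (forall k, 0 <= pairing e (nuR k)).
  by left.
rewrite -ltNge => k0N; right.
pose P k := pairing e (nuR k) < 0.
(* The parameter at which inequality [k] becomes tight; the edge ends at the smallest one over the
   decreasing inequalities. *)
pose t k := (lam k + pairing v (nuR k)) / - pairing e (nuR k).
have Dv := frame_region fr.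
have slack k : 0 <= lam k + pairing v (nuR k) by have := Dv k; lra.
case: (@arg_minP _ _ _ k0 P t k0N) => k Pk tk; exists (v + t k *: e), (t k).
have tpos : 0 < t k.
  (* A facet through [v] has slope 0 or 1 along the edge, so a decreasing inequality has positive
     slack at [v]. *)
  rewrite divr_gt0 ?oppr_gt0 // lt_neqAle slack andbT eq_sym; apply/eqP => h.
  have [i' ek] : exists i', k = tight fr i' by apply/tightP; lra.
  by move: Pk; rewrite /P ek edge_normal ltNge ler0n.
have tk0 := ltW tpos.
split => //; apply: tight_vertex => [j|y yT].
  rewrite pairingDl pairingZl; have [ej|ej] := leP 0 (pairing e (nuR j)).
    by apply: (le_trans (Dv j)); rewrite lerDl mulr_ge0.
  have := tk j ej; rewrite {2}/t ler_pdivlMr ?oppr_gt0 //; lra.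
(* The facets through [v] other than the [i]-th stay tight along the edge, so [y] is a multiple of
   [e]; the new facet [k], on which [e] does not vanish, makes the multiple zero. *)
have y0 i' : i' != i -> pairing y (nuR (tight fr i')) = 0.
  move=> ii; apply: yT; rewrite pairingDl pairingZl edge_normal.
  by rewrite eq_sym (negPf ii) mulr0 addr0 pairing_tight.
have yE : y = pairing y (nuR (tight fr i)) *: e.
  rewrite [LHS](edgeK fr) (bigD1 i) //= big1 ?addr0 // => i' ii.
  by rewrite y0 // scale0r.
have : pairing y (nuR k) = 0.
  apply: yT; rewrite pairingDl pairingZl /t.
  have : pairing e (nuR k) != 0 by rewrite lt_eqF.
  by move=> ?; field.
rewrite yE pairingZl => /eqP; rewrite mulf_eq0 => /orP[/eqP->|].
  by rewrite scale0r.
by rewrite lt_eqF.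
Qed.

End Frames.

(** * Finiteness of the vertex set, and a functional separating the vertices *)

Section Vertices.
Variables (R : realType) (n N : nat) (D : polyhedron R n N).
Local Notation nuR j := (realify R (normal D j)).
Local Notation lam j := (offset D j).

Definition vertices : {fset 'rV[R]_n} := fset_set (is_vertex (region D)).

(** A vertex is determined by the set of facets through it, because the normals of a frame span;
    there are finitely many such sets. *)
Lemma finite_vertices (hD : delzant D) : finite_set (is_vertex (region D)).
Proof.
pose F v := facets_through (normal D) (offset D) [set v].
pose g J : 'rV[R]_n := xget 0 [set v | is_vertex (region D) v /\ F v = J].
apply: (@sub_finite_set _ _ (g @` [set: {set 'I_N}])); last first.
  exact/finite_image/finite_finset.
move=> v vx; exists (F v) => //; rewrite /g; case: xgetP => [w _ [wx e]|]; last first.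
  by move=> /(_ v) [].
have [frv _] := delzant_frame hD vx; have [frw _] := delzant_frame hD wx.
apply/eqP; rewrite -subr_eq0; apply/eqP; apply: (frame_eq0 (fr := frv)) => i.
have : tight frv i \in F v.
  rewrite inE; apply/asboolP => _ ->; split; first exact: frame_region frv.
  exact: pairing_tight.
rewrite -e inE.
move=> /asboolP /(_ w erefl)[_ /= wi].
by rewrite pairingBl wi pairing_tight subrr.
Qed.

Lemma mem_vertices (hD : delzant D) v : v \in vertices <-> is_vertex (region D) v.
Proof.
rewrite in_fset_set; last exact: finite_vertices hD.
by rewrite in_setE.
Qed.

(** With [t j] taken as [a ^+ j], the difference of the values at two distinct vertices is a nonzero
    polynomial in [a], so some natural number [a] is a root for no pair. Nonnegative weights keep
    the functional bounded below on the polyhedron. *)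
Lemma generic_functional (hD : delzant D) : exists t : 'I_N -> R,
  (forall j, 0 <= t j) /\
  injective (fun v : vertices => pairing (val v) (\sum_j t j *: nuR j)).
Proof.
pose q (x : vertices * vertices) : {poly R} :=
  \sum_j pairing (val x.1 - val x.2) (nuR j) *: 'X^j.
have q_neq0 x : x.1 != x.2 -> q x != 0.
  apply: contra_neq => q0; apply/val_inj/eqP; rewrite -subr_eq0; apply/eqP.
  have [fr _] := delzant_frame hD ((mem_vertices hD _).1 (valP x.1)).
  apply: (frame_eq0 (fr := fr)) => i.
  have := congr1 (fun p : {poly R} => p`_(tight fr i)) q0.
  rewrite coef0 coef_sum (bigD1 (tight fr i)) //= coefZ coefXn eqxx mulr1.
  rewrite big1 ?addr0 // => j ji; rewrite coefZ coefXn.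
  by move: ji; rewrite -val_eqE eq_sym => /negPf ->; rewrite mulr0.
pose p := \prod_(x | x.1 != x.2) q x.
have p0 : p != 0 by apply/prodf_neq0.
have [a _ ra] : exists2 a : nat, true & ~~ root p a%:R.
  apply: contrapT => h.
  have /(max_poly_roots p0) : all (root p) [seq a%:R | a <- iota 0 (size p)].
    apply/allP => _ /mapP[a _ ->]; apply/negPn/negP => ra; apply: h.
    by exists a.
  rewrite size_map size_iota ltnn map_inj_uniq ?iota_uniq //; last first.
    exact: (mulrIn (oner_neq0 R)).
  by move=> /(_ isT).
exists (fun j : 'I_N => a%:R ^+ j); split=> [j|v w e]; first by rewrite exprn_ge0.
apply/eqP; apply: contraNT ra => vw; rewrite /root /p horner_prod.
apply/prodf_eq0; exists (v, w) => //=.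
rewrite horner_sum; apply/eqP.
transitivity (pairing (val v - val w) (\sum_(j < N) a%:R ^+ j *: nuR j)).
  rewrite pairing_sumr; apply: eq_bigr => j _.
  by rewrite hornerZ hornerXn pairingZr mulrC.
by rewrite pairingBl e subrr.
Qed.

End Vertices.

(** * Exponents and their lowest vertices *)

Section Heights.
Variables (R : realType) (n N : nat) (D : polyhedron R n N).
Hypothesis hD : delzant D.
Local Notation nuR j := (realify R (normal D j)).
Local Notation lam j := (offset D j).
Local Notation G := (R * 'rV[int]_n)%type.
Local Notation V := (vertices D).
Local Notation h := (Gamma_height D).
Local Notation th v c := (theta v (to_real c)).
Implicit Types (c : G) (v w : V).

Lemma thD (v : 'rV[R]_n) c c' : th v (c + c') = th v c + th v c'.
Proof. by rewrite /theta /= realifyD pairingDr addrACA. Qed.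

Lemma thMn (v : 'rV[R]_n) c k : th v (c *+ k) = th v c *+ k.
Proof.
elim: k => [|k IH]; last by rewrite !mulrS thD IH.
by rewrite !mulr0n /theta /= realify0 pairing0r addr0.
Qed.

Lemma th_sum (v : 'rV[R]_n) (I : Type) (r : seq I) (P : pred I) (F : I -> G) :
  th v (\sum_(i <- r | P i) F i) = \sum_(i <- r | P i) th v (F i).
Proof. exact: (big_morph (fun c => th v c) (thD v) (thMn v 0 0)). Qed.

Lemma thT (v : 'rV[R]_n) s : th v (s, 0) = s.
Proof. by rewrite /theta /= realify0 pairing0r addr0. Qed.

Let is_vertexP v : is_vertex (region D) (val v).
Proof. by apply/(mem_vertices hD)/valP. Qed.

Lemma height_attained c : exists v, h c = th (val v) c /\ forall w, h c <= th (val w) c.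
Proof.
have [x0 /(mem_vertices hD) v0] := has_vertex D.
case: (@arg_minP _ _ _ [` v0]%fset xpredT (fun v : V => th (val v) c) isT) => v _ vm.
suff -> : h c = th (val v) c by exists v; split => // w; apply: vm.
apply/eqP; rewrite eq_le; apply/andP; split.
  apply: ge_inf; last by exists (val v).
  by exists (th (val v) c) => _ [x /(mem_vertices hD) xv <-]; apply: (vm [` xv]%fset).
apply: lb_le_inf; first by exists (th (val v) c), (val v).
by move=> _ [x /(mem_vertices hD) xv <-]; apply: (vm [` xv]%fset).
Qed.

Lemma height_le v c : h c <= th (val v) c.
Proof. by have [_ [_]] := height_attained c; apply. Qed.

Lemma heightT s c : h ((s, 0) + c) = s + h c.
Proof.
have [v [e _]] := height_attained c; have [w [e' _]] := height_attained ((s, 0) + c).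
apply/eqP; rewrite eq_le; apply/andP; split.
  by rewrite e; apply: le_trans (height_le v _) _; rewrite thD thT.
by rewrite e' thD thT lerD2l height_le.
Qed.

Lemma height_eq v c : (forall w, th (val v) c <= th (val w) c) -> h c = th (val v) c.
Proof.
move=> vm; have [w [e _]] := height_attained c.
by apply/eqP; rewrite eq_le height_le e vm.
Qed.

Lemma Gamma_th_ge0 v c : Gamma D c -> 0 <= th (val v) c.
Proof.
by move=> Gc; apply: le_trans (height_le v c); apply: (height_ge0 (h := GammaM D)).
Qed.

Definition gamma j : G := (offset D j, normal D j).

Lemma Gamma_gamma j : Gamma D (gamma j). Proof. exact: Gamma_generator. Qed.

Lemma Gamma_add c c' : Gamma D c -> Gamma D c' -> Gamma D (c + c').
Proof. exact: (@hmD _ _ (GammaM D)). Qed.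

Lemma Gamma_sum (I : Type) (r : seq I) (P : pred I) (F : I -> G) :
  (forall i, P i -> Gamma D (F i)) -> Gamma D (\sum_(i <- r | P i) F i).
Proof.
move=> GF; elim/big_ind: _ => //; first exact: (hm0 (GammaM D)).
exact: Gamma_add.
Qed.

Lemma Gamma_mulrn c k : Gamma D c -> Gamma D (c *+ k).
Proof.
move=> Gc; elim: k => [|k IH]; first exact: (hm0 (GammaM D)).
by rewrite mulrS; apply: Gamma_add.
Qed.

Lemma GammaT s : 0 <= s -> Gamma D (s, 0).
Proof.
move=> s0; exists s, (fun=> 0); split=> //; rewrite /to_real /= realify0.
by rewrite !big1 ?addr0 // => j _; rewrite ?mul0r ?scale0r.
Qed.

Lemma th_gamma (v : 'rV[R]_n) j : th v (gamma j) = lam j + pairing v (nuR j).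
Proof. by []. Qed.

(** There are finitely many pairs of a vertex and a facet, so the least positive value serves, or 1
    if none is positive. *)
Lemma th_gap : exists2 e : R, 0 < e &
  forall v j, th (val v) (gamma j) = 0 \/ e <= th (val v) (gamma j).
Proof.
pose f (x : V * 'I_N) := th (val x.1) (gamma x.2).
have f0 x : 0 <= f x by apply/Gamma_th_ge0/Gamma_gamma.
have [[x fx]|no] := pselect (exists x, 0 < f x); last first.
  exists 1 => // v j; left; apply/eqP; rewrite eq_le (f0 (v, j)) andbT leNgt.
  by apply/negP => fx; apply: no; exists (v, j).
case: (@arg_minP _ _ _ x (fun x => 0 < f x) f fx) => y fy ym.
exists (f y) => // v j; have [e|e] := eqVneq (f (v, j)) 0; [by left|right].
by apply: (ym (v, j)); rewrite lt_neqAle eq_sym e f0.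
Qed.

Section Lowest.
Variable fr : forall v, frame D (val v).
Variable t : 'I_N -> R.
Hypothesis t_ge0 : forall j, 0 <= t j.
Let xi := \sum_j t j *: nuR j.
Hypothesis xi_inj : injective (fun v => pairing (val v) xi).

(** Since [xi] is a nonnegative combination of normals, an unbounded edge never descends; a
    descending edge therefore ends at another vertex. *)
Let xi_edge v i : (forall k, 0 <= pairing (edge (fr v) i) (nuR k)) ->
  0 <= pairing (edge (fr v) i) xi.
Proof.
by move=> e; rewrite pairing_sumr sumr_ge0 // => j _; rewrite pairingZr mulr_ge0.
Qed.

(** Along a bounded edge, theta of [c] cannot drop below its minimum at [v]; along an unbounded one,
    every generator of the cone pairs nonnegatively with the edge. *)
Let coordz_ge0 v c i : Gamma D c -> h c = th (val v) c -> 0 <= coordz (fr v) c.2 i.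
Proof.
move=> Gc hv; rewrite -(ler0z R) -pairing_edge.
have [e|[x [s [s0 /(mem_vertices hD) xv xE]]]] := edge_end (fr v) i.
  have [s [a [_ a0 [_ ->]]]] := Gc.
  by rewrite pairing_sumr sumr_ge0 // => j _; rewrite pairingZr mulr_ge0.
have := height_le [` xv]%fset c; rewrite hv /theta /= xE pairingDl pairingZl.
by rewrite lerD2l lerDl pmulr_rge0.
Qed.

(** Both sides have the same lattice part, so they differ by a power of T. The value of theta at
    [v], zero on the sum of generators, shows that the power is [h c]. *)
Let Gamma_coordz v c : Gamma D c -> h c = th (val v) c ->
  c = (h c, 0) + \sum_i gamma (tight (fr v) i) *+ absz (coordz (fr v) c.2 i).
Proof.
move=> Gc hv.
have absE i : (absz (coordz (fr v) c.2 i))%:Z = coordz (fr v) c.2 i.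
  by rewrite gez0_abs // coordz_ge0.
have cE : c.2 = (\sum_i gamma (tight (fr v) i) *+ absz (coordz (fr v) c.2 i)).2.
  rewrite raddf_sum {1}(coordzK (fr v) c.2); apply: eq_bigr => i _.
  by rewrite raddfMn /= -{1}absE -scaler_nat natz.
have thc : th (val v) (\sum_i gamma (tight (fr v) i) *+ absz (coordz (fr v) c.2 i)) = 0.
  rewrite th_sum big1 // => i _.
  by rewrite thMn th_gamma pairing_tight subrr mul0rn.
move: cE thc; set b := \sum_i _ => cE thc.
move: hv thc; case: c b cE {Gc absE} => l u [l' u'] /= ->.
move: (h _) => H; rewrite /theta /= => -> thc.
by congr (_, _); rewrite /= ?add0r // -addrA [X in _ + X]addrC thc addr0.
Qed.

Definition downward v i : bool := pairing (edge (fr v) i) xi < 0.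

(** The boolean [downward v i], read as 0 or 1, contributes the factor z_v. It forces the facets
    dual to descending edges to occur, which makes [v] the lowest vertex of the exponent. *)
Definition expo v (al : 'I_n -> nat) : G :=
  \sum_i gamma (tight (fr v) i) *+ (downward v i + al i).

Lemma Gamma_expo v al : Gamma D (expo v al).
Proof. by apply: Gamma_sum => i _; apply/Gamma_mulrn/Gamma_gamma. Qed.

Lemma th_expo v al : th (val v) (expo v al) = 0.
Proof.
rewrite th_sum big1 // => i _.
by rewrite thMn th_gamma pairing_tight subrr mul0rn.
Qed.

Lemma height_expo v al : h (expo v al) = 0.
Proof.
rewrite (@height_eq v) ?th_expo // => w.
exact/Gamma_th_ge0/Gamma_expo.
Qed.

(* The face of the polyhedron spanned by the upward edges at v. *)
Definition upface v w := forall i, downward v i ->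
  th (val w) (gamma (tight (fr v) i)) = 0.

(** Expand [w - v] in the edges at [v]: the coefficients are the values at [w] of theta on the tight
    generators, hence nonnegative, and they vanish on descending edges. *)
Lemma upface_le v w : upface v w -> pairing (val v) xi <= pairing (val w) xi.
Proof.
move=> vw; rewrite -subr_ge0 -pairingBl (pairing_frame (fr v)) sumr_ge0 // => i _.
have [/vw|] := boolP (downward v i).
  rewrite th_gamma pairingBl pairing_tight opprK addrC => ->.
  by rewrite mul0r.
rewrite -leNgt => e0; rewrite mulr_ge0 // pairingBl pairing_tight opprK addrC.
rewrite -th_gamma; exact/Gamma_th_ge0/Gamma_gamma.
Qed.

Lemma upface_lt v w : upface v w -> v != w -> pairing (val v) xi < pairing (val w) xi.
Proof.
move=> vw ne; rewrite lt_neqAle upface_le // andbT.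
by apply: contra_neq ne => /xi_inj.
Qed.

Lemma upface_expo v w al : th (val w) (expo v al) = 0 -> upface v w.
Proof.
move=> /eqP; rewrite th_sum psumr_eq0 => [/allP w0 i di|i _]; last first.
  exact/Gamma_th_ge0/Gamma_mulrn/Gamma_gamma.
have /= := w0 i (mem_index_enum i); rewrite thMn di -mulr_natr mulf_eq0.
by rewrite pnatr_eq0 orbF => /eqP.
Qed.

Definition lowest_spec c v := h c = th (val v) c /\
  forall w, h c = th (val w) c -> pairing (val v) xi <= pairing (val w) xi.

Lemma lowest_ex c : exists v, lowest_spec c v.
Proof.
have [v0 [/eqP v0c _]] := height_attained c.
case: (@arg_minP _ _ _ v0 (fun v => h c == th (val v) c)
  (fun v => pairing (val v) xi) v0c) => v /eqP vc vm.
by exists v; split => // w /eqP; apply: vm.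
Qed.

Definition lowest c : V := projT1 (cid (lowest_ex c)).

Lemma lowestP c : lowest_spec c (lowest c).
Proof. exact: projT2 (cid (lowest_ex c)). Qed.

Lemma lowest_unique c v : lowest_spec c v -> lowest c = v.
Proof.
have [e m] := lowestP c; move=> [e' m']; apply: xi_inj.
by apply/eqP; rewrite eq_le m //= m'.
Qed.

Lemma lowest_expo v al : lowest (expo v al) = v.
Proof.
apply: lowest_unique; split=> [|w]; rewrite height_expo ?th_expo //.
by move=> /esym /upface_expo /upface_le.
Qed.

Lemma lowestT s c : lowest ((s, 0) + c) = lowest c.
Proof.
have [e m] := lowestP c; apply: lowest_unique; split=> [|w].
  by rewrite heightT thD thT e.
by rewrite heightT thD thT => /addrI; apply: m.
Qed.

(** Apply [Gamma_coordz] at the lowest vertex. A zero coordinate on a descending edge would let the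
    far end of that edge attain the same height at a smaller value of [xi]; so the coordinate is at
    least 1 and the truncated subtraction is exact. *)
Lemma Gamma_expoE c : Gamma D c -> exists al, c = (h c, 0) + expo (lowest c) al.
Proof.
move=> Gc; have [hv vm] := lowestP c; set v := lowest c in hv vm *.
exists (fun i => absz (coordz (fr v) c.2 i) - downward v i)%N.
rewrite {1}(Gamma_coordz Gc hv); congr (_ + _); apply: eq_bigr => i _.
congr (_ *+ _); rewrite subnKC //.
have [di|//] := boolP (downward v i); rewrite /= absz_gt0 -(intr_eq0 R) -pairing_edge.
have [/xi_edge|[x [s [s0 /(mem_vertices hD) xv xE]]]] := edge_end (fr v) i.
  by move=> e; move: di; rewrite /downward ltNge e.
apply/eqP => e0; have := vm [` xv]%fset; rewrite hv /theta /= xE pairingDl pairingZl e0.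
rewrite mulr0 addr0 => /(_ erefl); rewrite pairingDl pairingZl lerDl.
by rewrite pmulr_rge0 // leNgt; move: di; rewrite /downward => ->.
Qed.

Lemma expo_inj v al al' : expo v al = expo v al' -> al =1 al'.
Proof.
move=> e i; apply: (@addnI (downward v i)).
have coordE be : coordz (fr v) (expo v be).2 i = (downward v i + be i)%:Z.
  rewrite /coordz raddf_sum mulmx_suml summxE (bigD1 i) //= big1 ?addr0.
    rewrite raddfMn /= -scaler_nat -scalemxAl mxE -/(coordz _ _ _).
    by rewrite coordz_normal eqxx mulr1 natz.
  move=> j ji; rewrite raddfMn /= -scaler_nat -scalemxAl mxE -/(coordz _ _ _).
  by rewrite coordz_normal eq_sym (negPf ji) mulr0.
by have := coordE al; rewrite e coordE => -[->].
Qed.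

Variable eps : R.
Hypothesis eps_gap : forall v j,
  th (val v) (gamma j) = 0 \/ eps <= th (val v) (gamma j).

(** By [Gamma_expoE] an exponent of height 0 is a sum of generators, so a nonzero value has a
    nonzero summand, and that summand is already at least [eps]. *)
Lemma height0_gap v c : Gamma D c -> h c = 0 ->
  th (val v) c = 0 \/ eps <= th (val v) c.
Proof.
move=> Gc hc; have [al cE] := Gamma_expoE Gc.
rewrite cE hc; move: (lowest c) => w.
have -> : ((0, 0) + expo w al)%R = expo w al by exact: add0r.
rewrite th_sum; set S := \sum_i _.
have [e0|] := eqVneq S 0; first by left.
rewrite /S psumr_neq0 => [/hasP[i _ /= i0]|i _]; last first.
  exact/Gamma_th_ge0/Gamma_mulrn/Gamma_gamma.
right; rewrite (bigD1 i) //= -[eps]addr0 lerD ?sumr_ge0 //; last first.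
  by move=> j _; apply/Gamma_th_ge0/Gamma_mulrn/Gamma_gamma.
move: i0; rewrite thMn; case: (_ + _)%N => [|k]; first by rewrite mulr0n ltxx.
have [->|e _] := eps_gap v (tight (fr w) i); first by rewrite mul0rn ltxx.
apply: (le_trans e); rewrite mulrS lerDl mulrn_wge0 //.
exact/Gamma_th_ge0/Gamma_gamma.
Qed.

(* Besides expo v al itself, these are the exponents of the leading part of
   Ehat v al. *)
Definition higher v c :=
  [/\ h c = 0, th (val v) c <> 0 & forall w, th (val w) c = 0 -> upface v w].

(** The lowest vertex of [c] lies on the upward face of [v], and it is not [v] because theta does
    not vanish there. *)
Lemma higher_lowest v c : higher v c ->
  pairing (val v) xi < pairing (val (lowest c)) xi.
Proof.
move=> [hc vc up]; have [e _] := lowestP c; apply: upface_lt.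
  by apply: up; rewrite -e.
by apply/eqP => ve; apply: vc; rewrite ve -e.
Qed.

Lemma expo_step v al i :
  expo v (fun j => al j + (i == j))%N = expo v al + gamma (tight (fr v) i).
Proof.
rewrite /expo [in RHS](bigD1 i) //= [in LHS](bigD1 i) //= eqxx addrAC
  addn1 addnS mulrSr.
congr (_ + _); apply: eq_bigr => j ji.
by rewrite eq_sym (negPf ji) addn0.
Qed.

(** The combinatorial core: multiplying a leading or higher exponent by a generator occurring in a
    linear form at [v] yields, below height [eps], only the new leading exponent or higher ones. A
    vertex where theta kills the sum kills both terms, so the upward face condition is inherited
    from [a]. *)
Lemma higher_step v al i a k :
  a = expo v al \/ (Gamma D a /\ higher v a) ->
  k = tight (fr v) i \/ th (val v) (gamma k) <> 0 ->
  h (a + gamma k) < eps ->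
  (a = expo v al /\ k = tight (fr v) i) \/ higher v (a + gamma k).
Proof.
move=> aP kP hlt.
have [Ga ha up] : [/\ Gamma D a, h a = 0 & forall w, th (val w) a = 0 -> upface v w].
  case: aP => [->|[Ga [ha _ up]]]; last by split.
  by split; [exact: Gamma_expo | exact: height_expo | move=> w /upface_expo].
have h0 : h (a + gamma k) = 0.
  (* At the minimizing vertex both terms are 0 or at least [eps]; a sum below [eps] leaves only
     0. *)
  have [w [e _]] := height_attained (a + gamma k); move: hlt; rewrite e thD.
  have a0 := Gamma_th_ge0 w Ga; have k0 := Gamma_th_ge0 w (Gamma_gamma k).
  have [->|ea] := height0_gap w Ga ha; last by move=> ?; lra.
  by have [->|ek] := eps_gap w k; [rewrite addr0 | move=> ?; lra].
have thlr w : th (val w) (a + gamma k) = 0 ->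
    th (val w) a = 0 /\ th (val w) (gamma k) = 0.
  rewrite thD; have a0 := Gamma_th_ge0 w Ga.
  by have k0 := Gamma_th_ge0 w (Gamma_gamma k); move=> ?; split; lra.
have [[-> ->]|ne] := pselect (a = expo v al /\ k = tight (fr v) i); first by left.
right; split => // [/thlr[va vk]|w /thlr[wa _]]; last exact: up.
case: kP => // ki; case: aP => [ai|[_ [_ + _]]]; last by apply.
by apply: ne.
Qed.

End Lowest.
End Heights.

(** * Coefficients and heights in the completed rings *)

Section CompletedCoef.
Variables (R : realType) (K : comNzRingType) (G : zmodType) (M : heightMonoid R G).
Implicit Types f g : completed K M.

Lemma completed_coef_sum (I : Type) (r : seq I) (P : pred I) (F : I -> completed K M) c :
  (\sum_(i <- r | P i) F i) c = \sum_(i <- r | P i) F i c.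
Proof. exact: (big_morph (fun f : completed K M => f c)). Qed.

Lemma coef_mulrz f (z : int) c : (f *~ z) c = f c *~ z.
Proof.
have coefMn k : (f *+ k) c = f c *+ k.
  by elim: k => // k IH; rewrite !mulrS Defs.coefD IH.
case: z => k; first exact: coefMn.
by rewrite NegzE !mulrNz Defs.coefN -!pmulrn coefMn.
Qed.

Lemma coefM_neq0 f g c : (f * g) c != 0 -> exists a, f a != 0 /\ g (c - a) != 0.
Proof.
move=> /(fsbigN1 (f := fun c a => f a * g (c - a)))[a _ fg]; exists a.
by split; apply: contraNneq fg => ->; rewrite ?mul0r ?mulr0.
Qed.

Lemma coefM_unique f g c a : (forall b, f b != 0 -> g (c - b) != 0 -> b = a) ->
  (f * g) c = f a * g (c - a).
Proof.
move=> ua; rewrite Defs.coefM /conv -(@fsbig_widen _ _ _ _ [set a]) ?fsbig_set1 //.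
move=> b [_ /= nba]; apply/eqP; apply: contra_notT nba => fg; apply: ua.
  by apply: contraNneq fg => ->; rewrite mul0r.
by apply: contraNneq fg => ->; rewrite mulr0.
Qed.

End CompletedCoef.

(** * Infinite series in the Novikov ring *)

Section NovikovSeries.
Variables (R : realType) (eps : R).
Hypothesis eps0 : 0 < eps.
Implicit Types a : nat -> novikov R.

Let bound (l : R) := Num.bound (`|l / eps|).

Let boundP l k : (bound l <= k)%N -> l < eps *+ k.
Proof.
move=> lk; rewrite -mulr_natr mulrC -ltr_pdivrMr //.
apply: le_lt_trans (ler_norm _) _; apply: lt_le_trans (archi_boundP _) _ => //.
by rewrite ler_nat.
Qed.

Lemma novikov_neg (x : novikov R) l : l < 0 -> x l = 0.
Proof.
move=> l0; apply/eqP; apply: contraTT l0 => /coef_supp.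
by rewrite -leNgt.
Qed.

Let nseries_fun a (l : R) : R[i] := \sum_(k < bound l) a k (l - eps *+ k).

(** Terms with [eps *+ k] beyond [l] vanish, as Novikov exponents are nonnegative; every
    sufficiently long cut-off gives the same value. *)
Let nseries_funE a l K : l < eps *+ K ->
  nseries_fun a l = \sum_(k < K) a k (l - eps *+ k).
Proof.
have mono m m' : (m <= m')%N -> l < eps *+ m ->
    \sum_(k < m) a k (l - eps *+ k) = \sum_(k < m') a k (l - eps *+ k).
  move=> mm lm; rewrite -!(big_mkord xpredT (fun k => a k (l - eps *+ k))).
  rewrite [RHS](big_cat_nat (n := m)) //=.
  rewrite [X in _ = _ + X]big_nat_cond [X in _ = _ + X]big1 ?addr0 //.
  move=> k /andP[/andP[mk _] _]; apply: novikov_neg; rewrite subr_lt0.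
  by apply: (lt_le_trans lm); rewrite ler_wpMn2l // ltW.
move=> lK; have [KB|/ltnW BK] := leqP K (bound l).
  by rewrite (mono _ _ KB).
by rewrite -(mono _ _ BK) //; apply: boundP.
Qed.

Let nseries_closed a : nseries_fun a \in @completed_pred R R[i] _ (novikov_exponents R).
Proof.
have nz l : nseries_fun a l != 0 ->
    exists k, (k < bound l)%N /\ a k (l - eps *+ k) != 0.
  move=> nzl; apply: contrapT => no; move/eqP: nzl; apply; apply: big1 => k _.
  by apply/eqP; apply: contrapT => /negP ak; apply: no; exists k.
apply/asboolP; split=> [l /nz[k [_ /coef_supp]]|E].
  by move=> /= h; apply: le_trans h _; rewrite gerBl mulrn_wge0 // ltW.
apply: (@sub_finite_set _ _ (\bigcup_(k in `I_(bound E))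
    [set s + eps *+ k | s in [set s | a k s != 0 /\ s <= E]])); last first.
  apply: bigcup_finite; first exact: finite_II.
  by move=> k _; apply: finite_image; apply: (coef_fin (a k)).
move=> l [/nz[k [_ akl]] /= lE]; have lk := coef_supp akl.
have k0 : 0 <= eps *+ k by rewrite mulrn_wge0 // ltW.
rewrite /= in lk; exists k.
  rewrite /= ltnNge; apply/negP => /boundP; rewrite ltNge => /negP; apply.
  by apply: le_trans lE; rewrite -subr_ge0.
by exists (l - eps *+ k); rewrite ?subrK //; split => //; lra.
Qed.

(* The sum of the series of terms T^(k eps) a_k. *)
Definition nseries a : novikov R := Completed (nseries_closed a).

Lemma coef_Tpow l (l0 : 0 <= l) (x : novikov R) s : (Tpow l0 * x) s = x (s - l).
Proof.
rewrite (@coefM_unique _ _ _ _ _ _ _ l); first by rewrite /= /delta eqxx mul1r.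
by move=> b; rewrite /= /delta; have [//|_] := eqVneq b l; rewrite eqxx.
Qed.

(** This recursion lets the limit coefficients in [generation] be peeled one step at a time. *)
Lemma nseriesS a : nseries a = a 0%N + Tpow (ltW eps0) * nseries (fun k => a k.+1).
Proof.
apply: completedP => l; rewrite Defs.coefD coef_Tpow.
have lK : l - eps < eps *+ bound (l - eps) by apply: boundP.
(* The cut-off is one more than that for [l - eps], so that removing the first term matches the
   series on the right. *)
rewrite [LHS](@nseries_funE _ _ (bound (l - eps)).+1); last first.
  by rewrite mulrS -ltrBlDl.
rewrite big_ord_recl /= mulr0n subr0; congr (_ + _).
by apply: eq_bigr => k _; rewrite /bump /= add1n mulrS opprD addrA.
Qed.

End NovikovSeries.

(** * Heights in the completed ring, and division by powers of T *)

Section Valuation.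
Variables (R : realType) (n N : nat) (D : polyhedron R n N).
Local Notation G := (R * 'rV[int]_n)%type.
Local Notation S := (LambdaH D).
Local Notation h := (Gamma_height D).
Implicit Types f g : S.

Lemma LH_coefD f g c : (f + g) c = f c + g c. Proof. by []. Qed.
Lemma LH_coefN f c : (- f) c = - f c. Proof. by []. Qed.

Lemma LH_coef_sum (I : Type) (r : seq I) (P : pred I) (F : I -> S) c :
  (\sum_(i <- r | P i) F i) c = \sum_(i <- r | P i) F i c.
Proof. exact: completed_coef_sum. Qed.

Lemma LH_coef_intM (z : int) f c : (z%:~R * f) c = z%:~R * f c.
Proof. by rewrite mulrzl; rewrite [LHS](coef_mulrz (M := GammaM D)) mulrzl. Qed.

Lemma embed_neq0 (a : novikov R) c : embed D a c != 0 -> a c.1 != 0 /\ c = (c.1, 0).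
Proof.
rewrite /= /embed_fun; case: c => s u /=.
have [->|_] := eqVneq u 0; last by rewrite eqxx.
by [].
Qed.

Lemma embedT (a : novikov R) s : embed D a (s, 0) = a s.
Proof. by rewrite /= /embed_fun /= eqxx. Qed.

Lemma scale_neq0 (a : novikov R) f c : (a *: f) c != 0 ->
  exists s, a s != 0 /\ f (c - (s, 0)) != 0.
Proof.
move=> /(@coefM_neq0 _ _ _ (GammaM D) (embed D a) f)[b [/embed_neq0[a0 be] fb]].
by exists b.1; rewrite -be.
Qed.

Lemma coef_scale (a : novikov R) f c l :
  (forall s, a s != 0 -> f (c - (s, 0)) != 0 -> s = l) ->
  (a *: f) c = a l * f (c - (l, 0)).
Proof.
move=> u; rewrite -(embedT a l).
apply: (@coefM_unique _ _ _ (GammaM D) (embed D a) f).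
by move=> b /embed_neq0[a0 be] fb; rewrite be; congr (_, _); apply: u; rewrite -?be.
Qed.

Lemma coef_TpowZ l (l0 : 0 <= l) f c : (Tpow l0 *: f) c = f (c - (l, 0)).
Proof.
rewrite (@coef_scale _ _ _ l); first by rewrite /= /delta eqxx mul1r.
by move=> s; rewrite /= /delta; have [//|_] := eqVneq s l; rewrite eqxx.
Qed.

(** The filtration step of height [E]. For [E] nonnegative it is the set of multiples of T^E, by
    [hge_Tpow] and [hge_div], hence it controls the T-adic topology. *)
Definition hge (E : R) f : Prop := forall c, f c != 0 -> E <= h c.

Lemma hge0 E : hge E 0.
Proof. by move=> c; rewrite eqxx. Qed.

Lemma hgeD E f g : hge E f -> hge E g -> hge E (f + g).
Proof.
move=> hf hg c; rewrite LH_coefD; have [->|/hf //] := eqVneq (f c) 0.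
by rewrite add0r; apply: hg.
Qed.

Lemma hgeN E f : hge E f -> hge E (- f).
Proof. by move=> hf c; rewrite LH_coefN oppr_eq0; apply: hf. Qed.

Lemma hgeB E f g : hge E f -> hge E g -> hge E (f - g).
Proof. by move=> hf /hgeN; apply: hgeD. Qed.

Lemma hge_sum (I : Type) (r : seq I) (P : pred I) (F : I -> S) E :
  (forall i, P i -> hge E (F i)) -> hge E (\sum_(i <- r | P i) F i).
Proof. by move=> hF; elim/big_ind: _ => //; [exact: hge0 | exact: hgeD]. Qed.

Lemma hge_le E E' f : E' <= E -> hge E f -> hge E' f.
Proof. by move=> le hf c /hf; apply: le_trans. Qed.

Lemma LH_coef_Gamma f c : f c != 0 -> Gamma D c.
Proof. exact: (@coef_supp _ _ _ (GammaM D)). Qed.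

Lemma heightM_ge f g b c : f b != 0 -> g (c - b) != 0 -> h b + h (c - b) <= h c.
Proof.
move=> /LH_coef_Gamma Gb /LH_coef_Gamma Gc.
have := @heightD _ _ (GammaM D) b (c - b) Gb Gc.
by rewrite (_ : b + (c - b) = c) // addrC subrK.
Qed.

Lemma hgeM E E' f g : hge E f -> hge E' g -> hge (E + E') (f * g).
Proof.
move=> hf hg c /(@coefM_neq0 _ _ _ (GammaM D))[b [fb gb]].
by apply: le_trans (heightM_ge fb gb); apply: lerD; [exact: hf | exact: hg].
Qed.

Lemma hge_ge0 f : hge 0 f.
Proof. by move=> c /LH_coef_Gamma; apply: (height_ge0 (h := GammaM D)). Qed.

Lemma hge_Mr E f g : hge E f -> hge E (g * f).
Proof. by move=> hf; rewrite -[E]add0r; apply: hgeM => //; apply: hge_ge0. Qed.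

Hypothesis hD : delzant D.
Variable fr : forall v : vertices D, frame D (val v).

Lemma hge_Tpow E (E0 : 0 <= E) F f : hge F f -> hge (E + F) (Tpow E0 *: f).
Proof.
move=> hf c; rewrite coef_TpowZ => /hf.
have -> : h c = E + h (c - (E, 0)) by rewrite -(heightT hD) addrC subrK.
by rewrite lerD2l.
Qed.

Lemma Gamma_shift E c : Gamma D c -> E <= h c -> Gamma D (c - (E, 0)).
Proof.
move=> Gc Eh; have [t [t0 tinj]] := generic_functional hD.
have [al cE] := Gamma_expoE hD fr t0 Gc.
have -> : c - (E, 0) = (h c - E, 0) + expo fr t (lowest hD t c) al.
  rewrite {1}cE addrAC; congr (_ + _).
  by rewrite /= -[RHS]/(_, _); congr (_, _); rewrite subr0.
by apply: Gamma_add; [apply: GammaT; rewrite subr_ge0 | exact: Gamma_expo].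
Qed.

(** Division shifts exponents: [Gamma_shift] keeps the support in the monoid, and heights drop by
    exactly [E], so finiteness below any height persists. *)
Lemma hge_div E (E0 : 0 <= E) f : hge E f -> exists w, f = Tpow E0 *: w.
Proof.
move=> hf.
have hsh c : h (c + (E, 0)) = E + h c by rewrite addrC heightT.
have cl : (fun c => f (c + (E, 0))) \in @completed_pred R R[i] _ (GammaM D).
  apply/asboolP; split=> [c f0|F].
    rewrite -(addrK (E, 0) c); apply: Gamma_shift; first exact: LH_coef_Gamma f0.
    exact: hf.
  apply: (@sub_finite_set _ _
    [set c - (E, 0) | c in [set c | f c != 0 /\ h c <= E + F]]).
    move=> c [f0 hc]; exists (c + (E, 0)); rewrite ?addrK //; split => //.
    by rewrite hsh lerD2l.
  by apply: finite_image; apply: (@coef_fin _ _ _ (GammaM D)).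
exists (Completed cl : S); apply: completedP => c.
by rewrite coef_TpowZ /= subrK.
Qed.

(** A Novikov series in the maximal ideal has exponents bounded away from 0, its support being
    finite below any bound; an ideal element involves finitely many such series. *)
Lemma eq_mod_max_hge f g : eq_mod_max f g -> exists2 e, 0 < e & hge e (f - g).
Proof.
have pos (a : novikov R) : novikov_max a ->
    exists2 e, 0 < e & forall l, a l != 0 -> e <= l.
  move=> am; have fin := coef_fin a 1.
  pose A := fset_set [set c | a c != 0 /\ height (novikov_exponents R) c <= 1].
  (* Starting the minimum at 1 covers the exponents above 1 and an empty list. *)
  pose e := \big[Num.min/1]_(l <- A) l.
  exists e => [|l al].
    rewrite /e big_seq; apply: (big_ind (fun x : R => 0 < x)) => // [x y x0 y0|l].
      by rewrite lt_min x0.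
    by rewrite in_fset_set // in_setE => -[/am].
  have [l1|l1] := leP l 1; last first.
    have e1 : e <= 1 by rewrite /e bigmin_le_id.
    exact: le_trans e1 (ltW l1).
  rewrite /e; apply: (@bigmin_inf_seq _ _ _ _ _ l xpredT l id) => //.
  by rewrite in_fset_set // in_setE.
move=> [m [a [s [sS ->]]]].
have sp i : exists e, 0 < e /\ hge e (s i).
  have [x xm <-] := sS i; have [e e0 xe] := pos x xm; exists e; split => //.
  move=> c; rewrite -[_ *: _]/(embed D x * 1) mulr1 => /embed_neq0[x0 ->].
  apply: (le_trans (xe _ x0)).
  rewrite -[(c.1, 0)]addr0 heightT // lerDl.
  exact/(height_ge0 (h := GammaM D))/(hm0 (GammaM D)).
have [e eP] := choice sp.
exists (\big[Num.min/1]_i e i).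
  apply: (big_ind (fun x : R => 0 < x)) => // [x y x0 y0|i _].
    by rewrite lt_min x0.
  by case: (eP i).
apply: hge_sum => i _; apply/hge_Mr; apply: hge_le (eP i).2.
exact: bigmin_le.
Qed.

End Valuation.

(** * The topological basis *)

Section LeadingTerms.
Variables (R : realType) (n N : nat) (D : polyhedron R n N).
Hypothesis hD : delzant D.
Local Notation G := (R * 'rV[int]_n)%type.
Local Notation S := (LambdaH D).
Local Notation h := (Gamma_height D).
Local Notation V := (vertices D).
Local Notation th v c := (theta v (to_real c)).
Local Notation gamma := (gamma D).

Variable fr : forall v : V, frame D (val v).
Variable t : 'I_N -> R.
Hypothesis t_ge0 : forall j, 0 <= t j.
Local Notation xi := (\sum_j t j *: realify R (normal D j)).
Hypothesis xi_inj : injective (fun v : V => pairing (val v) xi).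
Local Notation expo := (expo fr t).
Local Notation higher := (higher fr t).
Local Notation low := (lowest hD t).
Local Notation downward := (downward fr t).

Variables (zhat : 'I_N -> S) (eps : R).
Hypothesis eps0 : 0 < eps.
Hypothesis eps_gap : forall (v : V) j,
  th (val v) (gamma j) = 0 \/ eps <= th (val v) (gamma j).
Hypothesis eps_zhat : forall j, hge eps (zhat j - zmon D j).

(** The component of the relation [\sum_j nu_j zhat_j] along the [i]-th normal at [v]. *)
Definition lform (v : V) (i : 'I_n) : S :=
  \sum_j (coordz (fr v) (normal D j) i)%:~R * zhat j.

Lemma lform_coef v i c : h c < eps ->
  lform v i c = \sum_j (coordz (fr v) (normal D j) i)%:~R * delta R[i] (gamma j) c.
Proof.
move=> hc; rewrite LH_coef_sum; apply: eq_bigr => j _; rewrite LH_coef_intM.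
congr (_ * _); apply/eqP; rewrite -subr_eq0; apply: contraTT hc.
by rewrite -leNgt; apply: (eps_zhat (j := j)).
Qed.

Lemma coordz_th0 (v : V) j i : th (val v) (gamma j) = 0 ->
  coordz (fr v) (normal D j) i = (j == tight (fr v) i)%:R.
Proof.
rewrite th_gamma => th0.
have [k ->] : exists k, j = tight (fr v) k by apply/tightP; lra.
rewrite coordz_normal; have [->|ik] := eqVneq i k; first by rewrite eqxx.
case: eqP => // /(congr1 (fun j => coordz (fr v) (normal D j) k)).
by rewrite !coordz_normal eqxx eq_sym (negPf ik).
Qed.

Lemma th_tight (v : V) i : th (val v) (gamma (tight (fr v) i)) = 0.
Proof. by rewrite th_gamma pairing_tight subrr. Qed.

Lemma lform_lead v i : lform v i (gamma (tight (fr v) i)) = 1.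
Proof.
rewrite lform_coef; last first.
  by apply: le_lt_trans (height_le hD v _) _; rewrite th_tight.
rewrite (bigD1 (tight (fr v) i)) //= /delta eqxx coordz_th0 ?th_tight // eqxx.
rewrite big1 ?addr0 ?mulr1 // => j ji; case: eqP => [e|_]; last by rewrite mulr0.
by rewrite coordz_th0 ?(negPf ji) ?mul0r // -e th_tight.
Qed.

Lemma lform_supp v i c : lform v i c != 0 -> h c < eps ->
  exists k, c = gamma k /\ (k = tight (fr v) i \/ th (val v) (gamma k) <> 0).
Proof.
move=> + hc; rewrite lform_coef // => nz.
have [k nzk] : exists k,
    (coordz (fr v) (normal D k) i)%:~R * delta R[i] (gamma k) c != 0.
  apply: contrapT => no; move/eqP: nz; apply; apply: big1 => k _.
  by apply/eqP; apply: contrapT => /negP ?; apply: no; exists k.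
exists k; split.
  by move: nzk; rewrite /delta; have [//|_] := eqVneq c (gamma k); rewrite mulr0 eqxx.
have [/(coordz_th0 i)|] := pselect (th (val v) (gamma k) = 0); last by right.
move=> e; left; move: nzk; rewrite e.
by have [//|_] := eqVneq k (tight (fr v) i); rewrite mul0r eqxx.
Qed.

(** Below height [eps], [f] is the monomial [expo v al] plus terms at strictly higher vertices: a
    unitriangular shape for the order by [xi]. *)
Definition lead v al (f : S) : Prop := f (expo v al) = 1 /\
  forall c, f c != 0 -> h c < eps -> c = expo v al \/ higher v c.

Lemma Gamma_height_ge0 c : Gamma D c -> 0 <= h c.
Proof. exact: (height_ge0 (h := GammaM D)). Qed.

(** Every pair of exponents contributing below height [eps] falls under [higher_step]. Theta at [v]
    vanishes on the new leading exponent but on no higher one, so a single pair produces it, with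
    coefficient 1. *)
Lemma lead_step v al i f : lead v al f ->
  lead v (fun j => al j + (i == j))%N (f * lform v i).
Proof.
move=> [f1 fs].
have step b c : f b != 0 -> lform v i (c - b) != 0 -> h c < eps ->
    (b = expo v al /\ c = expo v al + gamma (tight (fr v) i)) \/ higher v c.
  move=> fb gb hc; have hbc := heightM_ge fb gb.
  have hb := Gamma_height_ge0 (LH_coef_Gamma fb).
  have hcb := Gamma_height_ge0 (LH_coef_Gamma gb).
  have [|k [ck kP]] := lform_supp gb; first by lra.
  have cE : c = b + gamma k by rewrite -ck addrC subrK.
  have bP : b = expo v al \/ Gamma D b /\ higher v b.
    have [|->|] := fs b fb; [by lra | by left | right; split => //].
    exact: LH_coef_Gamma fb.
  have := higher_step hD t_ge0 eps_gap bP kP; rewrite -cE => /(_ hc)[[be ke]|].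
    by left; split => //; rewrite cE be ke.
  by right.
rewrite /lead expo_step; split; last first.
  move=> c /(@coefM_neq0 _ _ _ (GammaM D))[b [fb gb]] hc.
  by have [[_ ->]|] := step b c fb gb hc; [left | right].
rewrite (@coefM_unique _ _ _ (GammaM D) f (lform v i) _ (expo v al)).
  by rewrite f1 mul1r addrC addKr lform_lead.
move=> b fb gb; have th0 : th (val v) (expo v al + gamma (tight (fr v) i)) = 0.
  by rewrite -expo_step th_expo.
have [|[]|[_ /(_ th0)]] // := step b _ fb gb.
by apply: le_lt_trans (height_le hD v _) _; rewrite th0.
Qed.

Definition bmon (v : V) : S := \prod_i zmon D (tight (fr v) i) ^+ downward v i.

Lemma bmon_coef v c : bmon v c = delta R[i] (expo v (fun=> 0%N)) c.
Proof.
rewrite /bmon /expo; pose P (f : S) a := forall c, f c = delta R[i] a c.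
have PM f a g b : P f a -> P g b -> P (f * g) (a + b).
  move=> fa gb {}c.
  have -> : (f * g) c = f a * g (c - a).
    apply: (@coefM_unique _ _ _ (GammaM D)) => b'.
    by rewrite fa /delta; have [//|_] := eqVneq b' a; rewrite eqxx.
  by rewrite fa gb /delta eqxx mul1r subr_eq addrC.
apply: (big_ind2 P) => [c'|f a g b|i _ c'] //; first exact: PM.
by rewrite addn0; case: (downward v i); rewrite ?expr1 ?expr0.
Qed.

Definition Ehat v (al : {ffun 'I_n -> nat}) : S :=
  bmon v * \prod_i lform v i ^+ al i.

Definition inc (al : {ffun 'I_n -> nat}) i : {ffun 'I_n -> nat} :=
  [ffun j => al j + (i == j)]%N.

Lemma Ehat0 v : Ehat v [ffun=> 0%N] = bmon v.
Proof. by rewrite /Ehat big1 ?mulr1 // => i _; rewrite ffunE expr0. Qed.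

Lemma incE al i j : inc al i j = (al j + (i == j))%N.
Proof. exact: ffunE. Qed.

Lemma Ehat_inc v al i : Ehat v (inc al i) = Ehat v al * lform v i.
Proof.
rewrite /Ehat -mulrA; congr (_ * _).
rewrite (bigD1 i) //= [in RHS](bigD1 i) //= incE eqxx addn1 exprSr.
rewrite (_ : \prod_(j | j != i) lform v j ^+ inc al i j =
  \prod_(j | j != i) lform v j ^+ al j); last first.
  by apply: eq_bigr => j ji; rewrite incE eq_sym (negPf ji) addn0.
exact: mulrAC.
Qed.

Lemma inc_ind (P : {ffun 'I_n -> nat} -> Prop) :
  P [ffun=> 0%N] -> (forall al i, P al -> P (inc al i)) -> forall al, P al.
Proof.
move=> P0 Pi al; move: {2}(\sum_i al i)%N (erefl (\sum_i al i)%N) => m.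
elim: m al => [|m IH] al.
  move=> /eqP; rewrite sum_nat_eq0 => /forallP al0.
  rewrite (_ : al = [ffun=> 0%N]) //; apply/ffunP => i; rewrite ffunE.
  by have /eqP := al0 i.
move=> sm; have [i ai] : exists i, (0 < al i)%N.
  apply: contrapT => no; move: sm; rewrite big1 // => i _; apply/eqP.
  by rewrite -leqn0 leqNgt; apply/negP => ?; apply: no; exists i.
pose be : {ffun 'I_n -> nat} := [ffun j => al j - (i == j)]%N.
have alE : al = inc be i.
  apply/ffunP => j; rewrite !ffunE subnK //.
  by case: eqP => // <-.
rewrite alE; apply/Pi/IH; apply/eqP; rewrite -eqSS -sm; apply/eqP.
rewrite (bigD1 i) //= [in RHS](bigD1 i) //= ffunE eqxx subn1 -addSn prednK //.
by congr addn; apply: eq_bigr => j ji; rewrite ffunE eq_sym (negPf ji) subn0.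
Qed.

Lemma Ehat_lead v (al : {ffun 'I_n -> nat}) : lead v al (Ehat v al).
Proof.
elim/inc_ind: al => [|al i]; last first.
  rewrite Ehat_inc => /(lead_step i); congr (lead v _ _).
  by apply/funext => j; rewrite ffunE.
have -> : [ffun=> 0%N] = (fun=> 0%N) :> ('I_n -> nat).
  by apply/funext => j; rewrite ffunE.
split=> [|c]; rewrite Ehat0 bmon_coef /delta ?eqxx //.
by have [-> _ _|_] := eqVneq c _; [left | rewrite eqxx].
Qed.

Local Notation X := (V * {ffun 'I_n -> nat})%type.
(** Lists may repeat an index, so concatenation is addition; [comb_group] collects the coefficients
    when this matters. *)
Definition comb (s : seq (novikov R * X)) : S :=
  \sum_(p <- s) p.1 *: Ehat p.2.1 p.2.2.

Lemma comb_cat s s' : comb (s ++ s') = comb s + comb s'.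
Proof. by rewrite /comb big_cat. Qed.

Lemma comb_scale a s : comb [seq (a * p.1, p.2) | p <- s] = a *: comb s.
Proof.
rewrite /comb big_map scaler_sumr; apply: eq_bigr => p _.
by rewrite scalerA.
Qed.

Lemma comb_seq1 a v al : comb [:: (a, (v, al))] = a *: Ehat v al.
Proof. by rewrite /comb big_seq1. Qed.

Let nmono_closed (z : R[i]) l :
  (fun s => if (s == l) && (0 <= l) then z else 0)
    \in @completed_pred R R[i] _ (novikov_exponents R).
Proof.
apply/asboolP; split=> [s|E].
  by case: andP => [[/eqP-> //]|]; rewrite eqxx.
apply: (sub_finite_set _ (finite_set1 l)) => s [].
by case: andP => [[/eqP-> //]|]; rewrite eqxx.
Qed.
(** The series z T^l; the guard makes it zero for negative [l], so no sign proof is carried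
    along. *)
Definition nmono (z : R[i]) l : novikov R := Completed (nmono_closed z l).

Lemma nmono_scale z l (f : S) c : 0 <= l -> (nmono z l *: f) c = z * f (c - (l, 0)).
Proof.
move=> l0; rewrite (@coef_scale _ _ _ _ _ _ _ l) /= ?eqxx ?l0 // => s.
by rewrite andbT; case: (eqVneq s l) => // _; rewrite eqxx.
Qed.

Lemma heightB s c : h (c - (s, 0)) = h c - s.
Proof.
have -> : h c = s + h (c - (s, 0)) by rewrite -(heightT hD) addrC subrK.
by rewrite addrAC subrr add0r.
Qed.

Lemma lowestB s c : low (c - (s, 0)) = low c.
Proof.
by rewrite -[in RHS](subrK (s, 0) c) [in RHS]addrC lowestT.
Qed.

Let rk (v : V) := #|[pred w : V | pairing (val v) xi < pairing (val w) xi]|.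

Let rk_lt v w : pairing (val v) xi < pairing (val w) xi -> (rk w < rk v)%N.
Proof.
move=> vw; apply: proper_card; apply/properP; split.
  by apply/fintype.subsetP => x; rewrite !inE; apply: lt_trans.
by exists w; rewrite !inE // ltxx.
Qed.

(** Triangular elimination: for each exponent [c] of [f] of height below [eps], subtract the
    multiple of [Ehat] led by [c]. What remains below [eps] sits at vertices of smaller rank [rk],
    and the induction is on the rank. *)
Lemma approx (f : S) : exists s, hge eps (f - comb s).
Proof.
suff claim m : forall f : S, (forall c, f c != 0 -> h c < eps -> (rk (low c) < m)%N) ->
    exists s, hge eps (f - comb s).
  apply: (claim #|{: V}|.+1) => c _ _; rewrite ltnS; exact: max_card.
elim: m {f} => [|m IH] f fm.
  exists [::]; rewrite /comb big_nil subr0 => c fc.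
  by rewrite leNgt; apply/negP => /(fm c fc).
have alP c : exists al : {ffun 'I_n -> nat}, Gamma D c ->
    c = (h c, 0) + expo (low c) al.
  have [Gc|nG] := pselect (Gamma D c); last by exists [ffun=> 0%N].
  have [al cE] := Gamma_expoE hD fr t_ge0 Gc; exists [ffun i => al i] => _.
  by rewrite {1}cE; congr (_ + _); apply: eq_bigr => i _; rewrite ffunE.
have [al alE] := choice alP.
pose A0 := [set c | f c != 0 /\ h c < eps].
have A0fin : finite_set A0.
  apply: sub_finite_set (@coef_fin _ _ _ (GammaM D) f eps) => c [fc /ltW hc].
  by split.
pose A := fset_set A0.
have AP c : reflect (f c != 0 /\ h c < eps) (c \in A).
  by apply: (iffP idP); rewrite in_fset_set // in_setE.
pose s0 : seq (novikov R * X) := [seq (nmono (f c) (h c), (low c, al c)) | c <- A].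
have [|s hs] := IH (f - comb s0); last first.
  by exists (s0 ++ s); rewrite comb_cat opprD addrA.
move=> c' fc' hc'; rewrite ltnNge; apply/negP => mc'; move/eqP: fc'; apply.
have combE : comb s0 c' = \sum_(c <- A) f c * Ehat (low c) (al c) (c' - (h c, 0)).
  rewrite /comb big_map LH_coef_sum big_seq [RHS]big_seq; apply: eq_bigr => c.
  by move=> /AP[fc _]; apply: nmono_scale; apply/Gamma_height_ge0/(LH_coef_Gamma fc).
(* Apart from its leading term, the element subtracted for [c] reaches only vertices of rank below
   that of [low c], hence below [m]. *)
have zero c : c \in A -> c != c' -> Ehat (low c) (al c) (c' - (h c, 0)) = 0.
  move=> /AP[fc hc] cc'; apply/eqP; apply: contraTT mc' => Ec; rewrite -ltnNge.
  have h0 := Gamma_height_ge0 (LH_coef_Gamma fc).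
  have [_ /(_ _ Ec)[||hi]] := Ehat_lead (low c) (al c).
  - by rewrite heightB; lra.
  - move=> e; move: cc'; rewrite (alE c (LH_coef_Gamma fc)) -e addrC subrK.
    by rewrite eqxx.
  - have := higher_lowest hD xi_inj hi; rewrite lowestB => /rk_lt lt.
    by apply: leq_trans lt _; rewrite -ltnS; apply: fm.
rewrite LH_coefD LH_coefN combE.
have [c'A|c'A] := boolP (c' \in A).
  rewrite (bigD1_seq c') ?fset_uniq // [X in _ - (_ + X)]big_seq_cond.
  rewrite [X in _ - (_ + X)]big1 => [|c /andP[cA cc']]; last by rewrite zero ?mulr0.
  have fc' : f c' != 0 by case/AP: c'A.
  have -> : c' - (h c', 0) = expo (low c') (al c').
    by rewrite {1}(alE c' (LH_coef_Gamma fc')) addrAC subrr add0r.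
  rewrite addr0; by have [-> _] := Ehat_lead (low c') (al c'); rewrite mulr1 subrr.
have -> : f c' = 0.
  by apply/eqP; apply: contraNT c'A => fc'; apply/AP.
rewrite big_seq big1 ?subr0 // => c cA; rewrite zero ?mulr0 //.
by apply: contraNneq c'A => <-.
Qed.

Let eps_ge0 : 0 <= eps := ltW eps0.

(** Divide the remainder of [approx] by T^eps and repeat. *)
Lemma approxn k (f : S) : exists s, hge (eps *+ k) (f - comb s).
Proof.
elim: k f => [|k IH] f; first by exists [::]; apply: hge_ge0.
have [s /(hge_div hD fr eps_ge0)[w fs]] := approx f; have [s' hs'] := IH w.
exists (s ++ [seq (Tpow eps_ge0 * p.1, p.2) | p <- s']).
rewrite comb_cat comb_scale opprD addrA fs -scalerBr mulrS.
exact: hge_Tpow.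
Qed.

Definition cf x s : novikov R := \sum_(p <- s | p.2 == x :> X) p.1.

Lemma seq_min (T : eqType) (s : seq T) (F : T -> R) x : x \in s ->
  exists2 y, y \in s & forall z, z \in s -> F y <= F z.
Proof.
elim: s x => // a s IH x _; case: s IH => [|b s] IH.
  by exists a; rewrite ?mem_head // => z; rewrite inE => /eqP->.
have [y ys ym] := IH b (mem_head _ _).
have [ay|ya] := leP (F a) (F y).
  exists a; rewrite ?mem_head // => z; rewrite inE => /predU1P[->//|/ym].
  exact: le_trans.
exists y; first by rewrite inE ys orbT.
by move=> z; rewrite inE => /predU1P[->|/ym //]; apply: ltW.
Qed.

Lemma comb_group s : comb s =
  \sum_(x <- undup (map snd s)) cf x s *: Ehat x.1 x.2.
Proof.
rewrite /cf; under [RHS]eq_bigr do rewrite scaler_suml.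
rewrite (exchange_big_dep xpredT) //= [LHS]big_seq [RHS]big_seq; apply: eq_bigr => p ps.
under eq_bigl do rewrite eq_sym.
by rewrite -big_filter filter_pred1_uniq ?undup_uniq ?mem_undup ?map_f ?big_seq1.
Qed.

(** Otherwise take the least exponent [l] in any coefficient and, among the indices whose
    coefficient involves T^l, one with the [xi]-lowest vertex. Its leading monomial times T^l
    survives in the sum at height below [E]. *)
Lemma comb_hge E s : hge E (comb s) -> forall x l, cf x s l != 0 -> E <= l.
Proof.
move=> hE x0 l0 cf0; rewrite leNgt; apply/negP => l0E.
pose u := undup (map snd s).
have cfu x l : cf x s l != 0 -> x \in u.
  apply: contraNT; rewrite mem_undup => xs; rewrite /cf big_seq_cond big_pred0 //.
  move=> p; apply/negP => /andP[ps /eqP px]; move: xs; rewrite -px.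
  by rewrite map_f.
pose L x := fset_set [set l | cf x s l != 0 /\ height (novikov_exponents R) l <= E].
have LP x l : reflect (cf x s l != 0 /\ l <= E) (l \in L x).
  have fin := @coef_fin _ _ _ (novikov_exponents R) (cf x s) E.
  by apply: (iffP idP); rewrite in_fset_set // in_setE.
pose LL := [seq (x, l) | x <- u, l <- L x].
have LLP x l : cf x s l != 0 -> l <= E -> (x, l) \in LL.
  move=> c0 lE; apply/allpairsPdep; exists x, l; split => //; first exact: cfu c0.
  by apply/LP.
have [[x1 l] x1L lmin] := seq_min snd (LLP _ _ cf0 (ltW l0E)).
have lE : l < E.
  by apply: (le_lt_trans _ l0E); apply: (lmin (x0, l0) (LLP _ _ cf0 (ltW l0E))).
have x1M : x1 \in [seq x <- u | cf x s l != 0].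
  move: x1L => /allpairsPdep[x [l' [xu /LP[c0 _] [-> ->]]]].
  by rewrite mem_filter c0.
have [x + xmin] := seq_min (fun x : X => pairing (val x.1) xi) x1M.
rewrite mem_filter => /andP[cx xu].
pose c : G := (l, 0) + expo x.1 x.2.
have hc : h c = l by rewrite heightT // height_expo // addr0.
(* Heights in [Ehat] are nonnegative, so a contributing power of T is at most [l], and by minimality
   it equals [l]. *)
have uniql y s' : cf y s s' != 0 -> Ehat y.1 y.2 (c - (s', 0)) != 0 -> s' = l.
  move=> cy /LH_coef_Gamma /Gamma_height_ge0; rewrite heightB hc subr_ge0 => sl.
  apply/eqP; rewrite eq_le sl /=; apply: (lmin (y, s')); apply: LLP => //.
  by apply: le_trans sl (ltW lE).
(* Another index would either share the leading exponent, hence coincide with [x], or have a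
   strictly lower vertex, against the choice of [x]. *)
have only y : y \in u -> y != x -> (cf y s *: Ehat y.1 y.2) c = 0.
  move=> yu yx; apply/eqP; apply: contraNT yx => /scale_neq0[s' [cy Ey]].
  have sl := uniql _ _ cy Ey; rewrite sl /c addrC addKr in cy Ey.
  have [_ /(_ _ Ey)[||hi]] := Ehat_lead y.1 y.2.
  - by rewrite height_expo.
  - move=> e; have e1 : x.1 = y.1.
      by rewrite -(lowest_expo hD fr xi_inj x.1 x.2) e lowest_expo.
    case: x y e e1 {yu cy Ey sl xu cx xmin c hc uniql} => [v al] [w be] /= e vw.
    rewrite -{}vw in e *; apply/eqP; congr (_, _); apply/ffunP => i.
    by rewrite (expo_inj e).
  - have := higher_lowest hD xi_inj hi; rewrite lowest_expo // ltNge xmin //.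
    by rewrite mem_filter cy yu.
have cE : comb s c = cf x s l.
  rewrite comb_group LH_coef_sum (bigD1_seq x) ?undup_uniq //.
  rewrite big_seq_cond big1 => [|y /andP[yu yx]]; last exact: only.
  rewrite [LHS]addr0 (@coef_scale _ _ _ _ _ _ _ l) => [|s']; last exact: uniql.
  rewrite /c addrC addKr; have [-> _] := Ehat_lead x.1 x.2.
  by rewrite mulr1.
by have := hE c; rewrite cE hc => /(_ cx); rewrite leNgt lE.
Qed.

End LeadingTerms.

(** * The quotient *)

Section QuotientMap.
Local Open Scope quotient_scope.
Variables (K : comNzRingType) (A : comAlgType K) (I : ringIdeal A).

Definition qpi (x : A) : quot_alg I := \pi_(Quotient.quot I) x.

Lemma qpi_eq x y : qpi x = qpi y <-> x - y \in (I : {pred A}).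
Proof.
split=> [e|]; first by rewrite Quotient.idealrBE; apply/eqP.
by rewrite Quotient.idealrBE => /eqP.
Qed.

Lemma qpi_surj q : exists x, qpi x = q.
Proof. by exists (repr (q : Quotient.quot I)); apply: reprK. Qed.

Lemma qpiD x y : qpi (x + y) = qpi x + qpi y.
Proof. exact: (raddfD (\pi_(Quotient.quot I))). Qed.

Lemma qpi0 : qpi 0 = 0.
Proof. exact: (raddf0 (\pi_(Quotient.quot I))). Qed.

Lemma qpiZ a x : qpi (a *: x) = a *: qpi x.
Proof.
apply/qpi_eq; rewrite -scalerBr -mulr_algl; apply: mul_stable.
apply/qpi_eq; rewrite -[LHS]/(qpi x).
by symmetry; apply: reprK.
Qed.

Lemma qpi_sum (J : Type) (r : seq J) (a : J -> K) (F : J -> A) :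
  qpi (\sum_(i <- r) a i *: F i) = \sum_(i <- r) a i *: qpi (F i).
Proof.
rewrite (big_morph qpi qpiD qpi0); apply: eq_bigr => i _; exact: qpiZ.
Qed.

End QuotientMap.

Section Quotient.
Variables (R : realType) (n N : nat) (D : polyhedron R n N).
Hypothesis hD : delzant D.
Local Notation G := (R * 'rV[int]_n)%type.
Local Notation S := (LambdaH D).
Local Notation h := (Gamma_height D).
Local Notation V := (vertices D).
Local Notation th v c := (theta v (to_real c)).
Local Notation gamma := (gamma D).

Variable fr : forall v : V, frame D (val v).
Variable t : 'I_N -> R.
Hypothesis t_ge0 : forall j, 0 <= t j.
Local Notation xi := (\sum_j t j *: realify R (normal D j)).
Hypothesis xi_inj : injective (fun v : V => pairing (val v) xi).

Variables (zhat : 'I_N -> S) (eps : R).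
Hypothesis eps0 : 0 < eps.
Hypothesis eps_gap : forall (v : V) j,
  th (val v) (gamma j) = 0 \/ eps <= th (val v) (gamma j).
Hypothesis eps_zhat : forall j, hge eps (zhat j - zmon D j).

Local Notation X := (V * {ffun 'I_n -> nat})%type.
Local Notation Ehat := (Ehat fr t zhat).
Local Notation bmon := (bmon fr t).
Local Notation comb := (comb fr t zhat).
Local Notation lform := (lform fr zhat).
Local Notation zero := ([ffun=> 0%N] : {ffun 'I_n -> nat}).
Let I := ideal_gen (range (linear_component zhat)).

Lemma lform_ideal v i : I (lform v i).
Proof.
have -> : lform v i =
    \sum_k (invmx (frame_mx (fr v)) k i)%:~R * linear_component zhat k.
  under [RHS]eq_bigr do rewrite mulr_sumr.
  rewrite exchange_big; apply: eq_bigr => j _ /=.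
  rewrite /coordz mxE rmorph_sum mulr_suml; apply: eq_bigr => k _.
  by rewrite mulrA rmorphM (mulrC (intr (normal D j 0 k))).
elim/big_ind: _ => [||k _]; [exact: ideal_gen0 | exact: ideal_genD |].
apply: ideal_genM; exists 1%N, (fun=> 1), (fun=> linear_component zhat k).
by split=> [_|]; [exists k | rewrite big_ord1 mul1r].
Qed.

Let ideal_genZ (a : novikov R) x : I x -> I (a *: x).
Proof. by rewrite -mulr_algl; apply: ideal_genM. Qed.

(** The converse of [lform_ideal]: at every vertex the linear forms generate the same ideal, the
    change of generators being unimodular. *)
Lemma linear_component_lform v k : linear_component zhat k =
  \sum_i (normal D (tight (fr v) i) 0 k)%:~R * lform v i.
Proof.
under [RHS]eq_bigr do rewrite mulr_sumr.
rewrite exchange_big; apply: eq_bigr => j _ /=.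
rewrite {1}(coordzK (fr v) (normal D j)) summxE rmorph_sum mulr_suml.
by apply: eq_bigr => i _; rewrite mxE rmorphM mulrA (mulrC (intr (coordz _ _ _))).
Qed.

Lemma inc_neq0 al i : inc al i != zero.
Proof.
apply/eqP => /ffunP /(_ i); rewrite incE ffunE eqxx addn1.
by [].
Qed.

Lemma Ehat_ideal v al : al != zero -> I (Ehat v al).
Proof.
elim/inc_ind: al => [|al i _ _]; first by rewrite eqxx.
by rewrite Ehat_inc; apply/ideal_genM/lform_ideal.
Qed.

Let eps_ge0 : 0 <= eps := ltW eps0.

(** Approximate the multiplier of each generator by a combination of [Ehat]. In a term at vertex [v]
    the generator is expanded in the linear forms at that same [v], so each product is again an
    [Ehat], with a nonzero index. *)
Lemma ideal_approx k y : I y -> exists2 s : seq (novikov R * X),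
  hge (eps *+ k) (y - comb s) & forall p, p \in s -> p.2.2 != zero.
Proof.
pose Q y := exists2 s : seq (novikov R * X),
  hge (eps *+ k) (y - comb s) & forall p, p \in s -> p.2.2 != zero.
have Q0 y' : hge (eps *+ k) y' -> Q y'.
  by move=> hy; exists [::] => //; rewrite /comb big_nil subr0.
have QD y' z' : Q y' -> Q z' -> Q (y' + z').
  move=> [s hs s0] [s' hs' s0']; exists (s ++ s').
    by rewrite comb_cat opprD addrACA; apply: hgeD.
  by move=> p; rewrite mem_cat => /orP[/s0|/s0'].
have QZ a v al i : Q (a *: Ehat v (inc al i)).
  exists [:: (a, (v, inc al i))]; first by rewrite comb_seq1 subrr; apply: hge0.
  by move=> p; rewrite inE => /eqP ->; apply: inc_neq0.
have Qsum (T : Type) (r : seq T) (F : T -> S) : (forall x, Q (F x)) ->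
    Q (\sum_(x <- r) F x).
  by move=> QF; elim/big_ind: _ => //; apply/Q0/hge0.
move=> [m [a [g [gI ->]]]]; apply: (Qsum) => i.
have [j _ <-] := gI i.
have [s hs] := approxn hD fr t_ge0 xi_inj eps0 eps_gap eps_zhat k (a i).
rewrite -(subrK (comb s) (a i)) mulrDl; apply: (QD).
  by apply: (Q0); rewrite mulrC; apply: hge_Mr.
rewrite /comb mulr_suml; apply: (Qsum) => -[b [v al]] /=.
rewrite (linear_component_lform v) mulr_sumr; apply: (Qsum) => l.
by rewrite -scalerAl mulrCA -Ehat_inc mulrzl -scalerMzr scalerMzl.
Qed.

Lemma comb_mod_ideal (s : seq (novikov R * X)) :
  exists c : V -> novikov R, I (comb s - \sum_v c v *: bmon v).
Proof.
elim: s => [|[a [v al]] s [c cI]].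
  exists (fun=> 0); rewrite /comb big_nil big1 ?subr0; first exact: ideal_gen0.
  by move=> v _; rewrite scale0r.
rewrite -cat1s comb_cat comb_seq1.
have [->|al0] := eqVneq al zero; last first.
  exists c; rewrite -addrA; apply: ideal_genD => //.
  by rewrite -mulr_algl; apply/ideal_genM/Ehat_ideal.
exists (fun w => c w + (if w == v then a else 0)).
under eq_bigr do rewrite scalerDl.
rewrite big_split /= (bigD1 (P := xpredT)
  (F := fun w => (if w == v then a else 0) *: bmon w) v) //=.
rewrite eqxx [X in _ + (_ + X)]big1 ?addr0; last first.
  by move=> w /negPf ->; rewrite scale0r.
by rewrite Ehat0 (addrC (a *: _)) opprD addrACA subrr addr0.
Qed.

(** Reduce modulo T^eps, drop the part in the ideal, divide the remainder by T^eps and iterate; the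
    coefficients found add up to the series [nseries]. After [k] rounds the error has height at
    least [eps *+ k], so the difference lies in the closure. *)
Lemma generation (f : S) : exists c : V -> novikov R,
  closed_ideal (range (linear_component zhat)) (f - \sum_v c v *: bmon v).
Proof.
have step (g : S) : exists x : (V -> novikov R) * S,
    I (g - \sum_v x.1 v *: bmon v - Tpow eps_ge0 *: x.2).
  have [s /(hge_div hD fr eps_ge0)[w gs]] :=
    approx hD fr t_ge0 xi_inj eps0 eps_gap eps_zhat g.
  have [c cI] := comb_mod_ideal s; exists (c, w) => /=.
  by rewrite -gs opprB addrC addrA subrK.
have [F FP] := choice step.
pose next g := (F g).2.
pose c f v := nseries eps0 (fun k => (F (iter k next f)).1 v).
have cE g v : c g v = (F g).1 v + Tpow eps_ge0 * c (next g) v.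
  rewrite /c nseriesS; congr (_ + Tpow _ * nseries _ _).
  by apply/funext => k; rewrite iterSr.
have telescope (U : zmodType) (x y z w u : U) :
    x - (y + z) - w = (x - y - u) + (u - z - w).
  by rewrite opprD !addrA subrK.
(* Stated for all [g], as the induction passes to the remainder [next g]. *)
have claim k : forall g, exists2 w, hge (eps *+ k) w &
    I (g - \sum_v c g v *: bmon v - w).
  elim: k => [|k IH] g.
    exists (g - \sum_v c g v *: bmon v); first exact: hge_ge0.
    by rewrite subrr; apply: ideal_gen0.
  have [w hw wI] := IH (next g); exists (Tpow eps_ge0 *: w).
    by rewrite mulrS; apply: hge_Tpow.
  have sumE : \sum_v c g v *: bmon v =
      \sum_v (F g).1 v *: bmon v + Tpow eps_ge0 *: \sum_v c (next g) v *: bmon v.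
    rewrite scaler_sumr -big_split; apply: eq_bigr => v _.
    by rewrite cE scalerDl scalerA.
  rewrite sumE (telescope _ _ _ _ _ (Tpow eps_ge0 *: next g)) -!scalerBr.
  by apply: ideal_genD; [exact: FP | exact: ideal_genZ].
exists (c f); apply/closed_idealP => E E0.
have [w hw wI] := claim (Num.bound (E / eps)) f.
exists (f - \sum_v c f v *: bmon v - w) => //.
have [|u ->] := hge_div hD fr E0 (f := w).
  apply: hge_le hw; rewrite -mulr_natr mulrC -ler_pdivrMr //.
  by rewrite ltW // archi_boundP // divr_ge0.
by exists (- u); rewrite scalerN.
Qed.

(** If T^l occurred in [c v], approximate the combination beyond [l] by an element of the ideal, and
    this by terms [Ehat] with nonzero index. Their difference contradicts [comb_hge]. *)
Lemma independence (s : seq V) (c : V -> novikov R) : uniq s ->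
  closed_ideal (range (linear_component zhat)) (\sum_(v <- s) c v *: bmon v) ->
  forall v, v \in s -> c v = 0.
Proof.
move=> us /closed_idealP cl v vs; apply: completedP => l; apply/eqP.
apply: contrapT => /negP cl0.
pose k := Num.bound (`|l / eps|).
have lk : l < eps *+ k.
  rewrite -mulr_natr mulrC -ltr_pdivrMr //.
  by apply: le_lt_trans (ler_norm _) _; apply: archi_boundP.
have ek0 : 0 <= eps *+ k by rewrite mulrn_wge0.
have [y yI [w ye]] := cl _ ek0.
have [s' hs' s'0] := ideal_approx k yI.
pose s1 := [seq (c v, (v, zero)) | v <- s] ++ [seq (-1 * p.1, p.2) | p <- s'].
have hs1 : hge (eps *+ k) (comb s1).
  rewrite comb_cat comb_scale scaleN1r {1}/comb big_map.
  under eq_bigr do rewrite /= Ehat0.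
  have -> : \sum_(v <- s) c v *: bmon v = y - Tpow ek0 *: w by rewrite ye addrK.
  rewrite addrAC; apply: hgeB => //.
  by have := hge_Tpow hD (E0 := ek0) (@hge_ge0 _ _ _ D w); rewrite addr0.
(* The terms from the ideal have nonzero index, so they leave the coefficient at [(v, zero)]
   untouched. *)
have cfE : cf (v, zero) s1 = c v.
  rewrite /cf big_cat !big_map /= [X in _ + X]big_seq_cond [X in _ + X]big_pred0 ?addr0.
    rewrite big_mkcond (bigD1_seq v) //= eqxx big1 ?addr0 // => w' /negPf w'v.
    by rewrite xpair_eqE w'v.
  move=> p; apply/negP => /andP[/s'0 + /eqP e]; rewrite e.
  by rewrite eqxx.
have := comb_hge hD t_ge0 xi_inj eps0 eps_gap eps_zhat hs1 (x := (v, zero)) (l := l).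
by rewrite cfE leNgt lk => /(_ cl0).
Qed.

(** The basis is the image of the monomials [bmon v]; as there are finitely many vertices,
    [generation] provides finite combinations. *)
Lemma quotient_free : free_module (quotient_algebra zhat).
Proof.
pose C := closed_ideal (range (linear_component zhat)).
exists V, (fun v => qpi (RingIdeal.clone _ C _) (bmon v)); split.
  move=> m; have [f <-] := qpi_surj m.
  have [c cI] := generation f; exists (index_enum _), c.
  by rewrite -qpi_sum; apply/qpi_eq.
move=> s c us e; apply: (independence us).
move: e; rewrite -qpi_sum -(qpi0 (RingIdeal.clone _ C _)) => /qpi_eq.
by rewrite subr0.
Qed.

End Quotient.

Theorem theorem1 (R : realType) (n N : nat) (D : polyhedron R n N)
    (hD : delzant D) (zhat : 'I_N -> LambdaH D)
    (hzhat : forall j : 'I_N, eq_mod_max (zhat j) (zmon D j)) :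
  free_module (quotient_algebra zhat).
Proof.
have exfr (v : vertices D) : exists fr : frame D (val v), True.
  by apply: delzant_frame => //; apply/(mem_vertices hD)/valP.
pose fr v := projT1 (cid (exfr v)).
have [t [t0 tinj]] := generic_functional hD.
have [e1 e10 gap] := th_gap hD.
have exe j : exists e, 0 < e /\ hge e (zhat j - zmon D j).
  by have [e] := eq_mod_max_hge hD (hzhat j); exists e.
have [e eP] := choice exe.
(* Small enough both for the gap of theta on the generators and for the height of every
   [zhat j - zmon D j]. *)
pose eps : R := \big[Num.min/e1]_j e j.
have eps0 : 0 < eps.
  apply: (big_ind (fun x : R => 0 < x)) => // [x y x0 y0|j _].
    by rewrite lt_min x0.
  by case: (eP j).
apply: (quotient_free hD fr t0 tinj eps0) => [v j|j].
  have [|ge] := gap v j; [by left | right].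
  by apply: le_trans ge; rewrite /eps bigmin_le_id.
by apply: hge_le (eP j).2; apply: bigmin_le.
Qed.
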